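(* The matroids $M(K_6)$ and $H_{12}^*$ are excluded minors for the class of even-cut matroids; that is, neither is an even-cut matroid, but every proper minor of each of them is.
   Context: An even-cut matroid is a matroid representable by a binary matrix having a row whose removal yields a matrix representing a cographic matroid. $H_{12}$ is the vector matroid over $\mathrm{GF}(2)$ of the matrix with rows $101010101010$, $000011110000$, $000011001100$, $110000000011$, $001100110011$, and $H_{12}^*$ is its dual. *)

(* Defs.v *)
From HB Require Import structures.
From mathcomp Require Import all_boot all_order all_algebra.

Set Implicit Arguments.
Unset Strict Implicit.
Unset Printing Implicit Defensive.

Import GRing.Theory.
Local Open Scope ring_scope.

(* The ground set is a subset of T rather than T itself, so that minors of a
   matroid on T are again matroids on T. *)
Record matroid (T : finType) := Matroid {
  ground : {set T};
  indep : {set {set T}};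
  indep_ground : forall X, X \in indep -> X \subset ground;
  indep0 : set0 \in indep;
  indep_sub : forall X Y : {set T}, X \subset Y -> Y \in indep -> X \in indep;
  indep_aug : forall X Y : {set T},
    X \in indep -> Y \in indep -> (#|X| < #|Y|)%N ->
    exists2 e, e \in Y :\: X & e |: X \in indep }.

Definition bases (T : finType) (M : matroid T) : {set {set T}} :=
  [set B | maxset (mem (indep M)) B].

(* Phrased on ground sets, not on the ambient types: with a map T -> U the
   matroid with empty ground set on an inhabited T would not be isomorphic to
   the one on an empty U. *)
Definition matroid_iso (T U : finType) (M : matroid T) (N : matroid U) : Prop :=
  exists f : {x : T | x \in ground M} -> {y : U | y \in ground N},
    bijective f /\
    forall X : {set {x : T | x \in ground M}},
      ((val @: X) \in indep M) = ((val @: (f @: X)) \in indep N).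

Section Dual.

Variables (T : finType) (M : matroid T).
Implicit Types B X Y : {set T}.

Definition dual_indep : {set {set T}} :=
  [set X : {set T} | [exists B in bases M, X \subset ground M :\: B]].

Lemma dual_indepP X :
  reflect (exists2 B, B \in bases M & X \subset ground M :\: B)
          (X \in dual_indep).
Proof. by rewrite inE; apply: (iffP exists_inP). Qed.

Lemma bases_indep B : B \in bases M -> B \in indep M.
Proof. by rewrite inE => /maxsetp. Qed.

Lemma indep_extend X Y : X \in indep M -> Y \in indep M -> (#|X| <= #|Y|)%N ->
  exists Z, [/\ Z \in indep M, X \subset Z, Z \subset X :|: Y & #|Z| = #|Y|].
Proof.
move: {2}(#|Y| - #|X|)%N (leqnn (#|Y| - #|X|)) => n.
elim: n X => [|n IHn] X leYX iX iY leXY.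
  exists X; split=> //; first exact: subsetUl.
  by apply/eqP; rewrite eqn_leq leXY -subn_eq0 -leqn0.
have [ltXY|leYX'] := ltnP #|X| #|Y|; last first.
  exists X; split=> //; first exact: subsetUl.
  by apply/eqP; rewrite eqn_leq leXY.
have [e] := indep_aug iX iY ltXY; rewrite inE => /andP[eX eY] iX'.
have cX' : #|e |: X| = #|X|.+1 by rewrite cardsU1 eX.
have [||Z [iZ sZ sZ' cZ]] := IHn _ _ iX' iY; rewrite ?cX' //.
  by rewrite subnS -subn1 leq_subLR add1n.
exists Z; split=> //; first exact: subset_trans (subsetUr _ _) sZ.
apply: subset_trans sZ' _; rewrite !subUset sub1set subsetUl subsetUr.
by rewrite inE eY orbT.
Qed.

Lemma basis_max B X : B \in bases M -> X \in indep M -> (#|X| <= #|B|)%N.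
Proof.
move=> bB iX; rewrite leqNgt; apply/negP => ltBX.
have [e] := indep_aug (bases_indep bB) iX ltBX; rewrite inE => /andP[/negP eB _] ieB.
move: bB; rewrite inE => /maxsetP[_ /(_ _ ieB (subsetUr _ _)) eqB].
by case: eB; rewrite -eqB setU11.
Qed.

Lemma card_basis B X :
  B \in bases M -> X \in indep M -> #|X| = #|B| -> X \in bases M.
Proof.
move=> bB iX cX; rewrite inE; apply/maxsetP; split=> // Y iY sXY.
by apply/eqP; rewrite eq_sym eqEcard sXY cX basis_max.
Qed.

Lemma dual_ground X : X \in dual_indep -> X \subset ground M.
Proof. by case/dual_indepP=> B _ /subset_trans; apply; apply: subsetDl. Qed.

Lemma dual0 : set0 \in dual_indep.
Proof.
have [B bB _] := @maxset_exists _ (mem (indep M)) _ (indep0 M).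
by apply/dual_indepP; exists B; rewrite ?inE ?sub0set.
Qed.

Lemma dual_sub X Y : X \subset Y -> Y \in dual_indep -> X \in dual_indep.
Proof.
move=> sXY /dual_indepP[B bB sY]; apply/dual_indepP; exists B => //.
exact: subset_trans sXY sY.
Qed.

Lemma dual_aug X Y : X \in dual_indep -> Y \in dual_indep -> (#|X| < #|Y|)%N ->
  exists2 e, e \in Y :\: X & e |: X \in dual_indep.
Proof.
case/dual_indepP=> BX bX /[1!subsetD]/andP[sX dX].
case/dual_indepP=> BY bY /[1!subsetD]/andP[sY dY] ltXY.
have iBYX : BY :\: X \in indep M.
  exact: indep_sub (subsetDl _ _) (bases_indep bY).
have [B [iB sB sB' cB]] :=
  indep_extend iBYX (bases_indep bX) (basis_max bX iBYX).
have bB := card_basis bX iB cB.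
have dBX : [disjoint X & B].
  apply/pred0P => z /=; apply/negP => /andP[zX /(subsetP sB')].
  by rewrite !inE zX /= => zBX; move/pred0P/(_ z): dX; rewrite /= zX zBX.
have [/subsetPn[e eYX eB]|] := boolP (~~ (Y :\: X \subset B)).
  exists e => //; apply/dual_indepP; exists B => //.
  move: eYX; rewrite inE => /andP[_ eY].
  rewrite subsetD subUset sub1set sX (subsetP sY) //=.
  apply/pred0P => z; rewrite /= !inE; case: eqP => [->|_] /=.
    exact: negbTE.
  exact: (pred0P dBX z).
rewrite negbK => sYXB.
have /subset_leq_card : (BY :\: X) :|: (Y :\: X) \subset B.
  by rewrite subUset sB.
rewrite cardsU disjoint_setI0 ?cards0 ?subn0; last first.
  apply: disjointWl (subsetDl _ _) _; apply: disjointWr (subsetDl _ _) _.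
  by rewrite disjoint_sym.
rewrite cB => leB.
have := leq_trans leB (basis_max bY (bases_indep bX)).
rewrite -(cardsID X BY) addnC leq_add2r => le1.
have le2 : (#|BY :&: X| <= #|X :\: Y|)%N.
  apply: subset_leq_card; apply/subsetP=> z; rewrite !inE => /andP[zB zX].
  rewrite zX andbT; apply/negP => zY.
  by move/pred0P/(_ z): dY; rewrite /= zY zB.
have := leq_trans le1 le2.
rewrite -(leq_add2l #|X :&: Y|) {1}setIC !cardsID leqNgt.
by rewrite ltXY.
Qed.

Definition dual : matroid T := Matroid dual_ground dual0 dual_sub dual_aug.

End Dual.

Section Minors.

Variables (T : finType) (M : matroid T) (D : {set T}).
Implicit Types X Y : {set T}.

Definition delete_indep : {set {set T}} :=
  [set X in indep M | X \subset ground M :\: D].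

Lemma delete_ground X : X \in delete_indep -> X \subset ground M :\: D.
Proof. by rewrite inE => /andP[]. Qed.

Lemma delete0 : set0 \in delete_indep.
Proof. by rewrite inE indep0 sub0set. Qed.

Lemma delete_sub X Y : X \subset Y -> Y \in delete_indep -> X \in delete_indep.
Proof.
move=> sXY; rewrite !inE => /andP[iY sY].
by rewrite (indep_sub sXY iY) (subset_trans sXY sY).
Qed.

Lemma delete_aug X Y :
  X \in delete_indep -> Y \in delete_indep -> (#|X| < #|Y|)%N ->
  exists2 e, e \in Y :\: X & e |: X \in delete_indep.
Proof.
rewrite [X \in _]inE [Y \in _]inE => /andP[iX sX] /andP[iY sY] ltXY.
have [e eYX ieX] := indep_aug iX iY ltXY; exists e => //.
rewrite inE ieX subUset sub1set sX andbT; apply: (subsetP sY).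
by move: eYX; rewrite inE => /andP[].
Qed.

Definition delete : matroid T :=
  Matroid delete_ground delete0 delete_sub delete_aug.

End Minors.

Definition contract (T : finType) (M : matroid T) (C : {set T}) : matroid T :=
  dual (delete (dual M) C).

Definition proper_minor (T : finType) (N M : matroid T) : Prop :=
  exists C D : {set T},
    [/\ C :|: D \subset ground M, [disjoint C & D], C :|: D != set0
      & N = contract (delete M D) C].

Definition excluded_minor (P : forall T : finType, matroid T -> Prop)
    (T : finType) (M : matroid T) : Prop :=
  ~ P T M /\ forall N : matroid T, proper_minor N M -> P T N.

Section FreeFamily.

Variables (F : fieldType) (vT : vectType F) (T : finType) (v : T -> vT).
Implicit Types X Y : {set T}.

Definition free_sets : {set {set T}} := [set X : {set T} | free [seq v x | x in X]].

Lemma free_sets0 : set0 \in free_sets.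
Proof. by rewrite inE /image_mem enum_set0 nil_free. Qed.

Lemma free_sets_perm X (s : seq T) :
  uniq s -> s =i X -> (X \in free_sets) = free (map v s).
Proof.
move=> us sX; rewrite inE; apply/perm_free/perm_map.
by apply: uniq_perm; rewrite ?enum_uniq // => x; rewrite mem_enum sX.
Qed.

Lemma free_sets_sub X Y : X \subset Y -> Y \in free_sets -> X \in free_sets.
Proof.
move=> sXY; rewrite (@free_sets_perm Y (enum X ++ enum (Y :\: X))).
- by rewrite map_cat inE => /catl_free.
- rewrite cat_uniq !enum_uniq andbT /=; apply/hasPn=> x.
  by rewrite !mem_enum inE => /andP[].
move=> x; rewrite mem_cat !mem_enum inE.
by have [/(subsetP sXY)|] := boolP (x \in X).
Qed.

Lemma free_sets1 e X : e \notin X ->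
  (e |: X \in free_sets) = (v e \notin <<[seq v x | x in X]>>%VS) && (X \in free_sets).
Proof.
move=> eX; rewrite (@free_sets_perm _ (e :: enum X)) /=.
- by rewrite free_cons inE.
- by rewrite mem_enum eX enum_uniq.
by move=> x; rewrite !inE mem_enum.
Qed.

Lemma free_sets_aug X Y : X \in free_sets -> Y \in free_sets -> (#|X| < #|Y|)%N ->
  exists2 e, e \in Y :\: X & e |: X \in free_sets.
Proof.
move=> fX; rewrite inE /free => /eqP dY ltXY.
have [sYX|] := boolP (<<[seq v x | x in Y]>> <= <<[seq v x | x in X]>>)%VS.
  have := leq_trans (dimvS sYX) (dim_span _).
  by rewrite dY !size_image leqNgt ltXY.
move/span_subvP => nYX.
have [/exists_inP[e eY nX]|/existsPn nex] :=
  boolP [exists e in Y, v e \notin <<[seq v x | x in X]>>%VS]; last first.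
  case: nYX => _ /imageP[y yY ->].
  by have := nex y; rewrite negb_and yY /= negbK.
have eX : e \notin X by apply: contra nX => eX; apply/memv_span/imageP; exists e.
by exists e; [rewrite inE eX | rewrite free_sets1 ?nX].
Qed.

End FreeFamily.

Definition vector_matroid (F : fieldType) (m n : nat) (A : 'M[F]_(m, n)) :
    matroid 'I_n :=
  @Matroid _ [set: 'I_n] (free_sets (fun j => col j A))
    (fun X _ => subsetT X) (free_sets0 _) (@free_sets_sub _ _ _ _)
    (@free_sets_aug _ _ _ _).

(* Finite graphs with loops and parallel edges allowed; the order of the two
   ends of an edge is immaterial. *)
Record graph := Graph {
  vertex : finType;
  edge : finType;
  ends : edge -> vertex * vertex }.

Section CycleMatroid.

Variable G : graph.
Local Notation V := (vertex G).
Local Notation E := (edge G).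
Implicit Types (e f : E) (u w x y : V) (s : seq (V * E)) (X Y : {set E}).

Definition joins e x y : bool := (ends e == (x, y)) || (ends e == (y, x)).

(* [:: (v1, e1); ...; (vk, ek)] with e_i joining v_i to v_(i+1), indices being
   taken modulo k; k = 1 is a loop and k = 2 a pair of parallel edges. *)
Definition graph_cycle s : bool :=
  [&& s != [::], uniq (unzip1 s), uniq (unzip2 s)
    & cycle (fun p q : V * E => joins p.2 p.1 q.1) s].

(* The length of a cycle is at most the number of vertices, so the bound is
   only there to make the quantifier finite; see forestP. *)
Definition forest X : bool :=
  ~~ [exists k : 'I_#|V|.+1, exists s : k.-tuple (V * E),
        graph_cycle s && all (mem X) (unzip2 s)].

Lemma forestP X :
  reflect (forall s, graph_cycle s -> ~~ all (mem X) (unzip2 s)) (forest X).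
Proof.
apply: (iffP idP) => [/existsPn fX s cs|fX].
  have sz : (size s < #|V|.+1)%N.
    case/and4P: cs => _ us _ _; rewrite ltnS -(size_map fst).
    by rewrite -(card_uniqP us) max_card.
  have /existsPn/(_ (in_tuple s)) := fX (Ordinal sz).
  by rewrite negb_and cs.
apply/existsPn => k; apply/existsPn => s; rewrite negb_and -implybE.
by apply/implyP/fX.
Qed.

Definition vertex_vec x : 'rV['F_2]_#|V| := delta_mx 0 (enum_rank x).
Definition edge_vec e := vertex_vec (ends e).1 + vertex_vec (ends e).2.

Lemma edge_vecE e x y : joins e x y -> edge_vec e = vertex_vec x + vertex_vec y.
Proof. by rewrite /edge_vec => /orP[] /eqP -> //=; rewrite addrC. Qed.

Lemma F2_addvv (n : nat) (v : 'rV['F_2]_n) : v + v = 0.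
Proof.
apply/rowP => i; rewrite !mxE -mulr2n -mulr_natr.
by rewrite [2%:R](_ : _ = 0) ?mulr0 //; apply/val_inj.
Qed.

Lemma walk_vec (p q : V * E) s :
  path (fun p q : V * E => joins p.2 p.1 q.1) p (rcons s q) ->
  vertex_vec p.1 + vertex_vec q.1 =
    edge_vec p.2 + \sum_(e <- unzip2 s) edge_vec e.
Proof.
elim: s p => [|r s IHs] p /=.
  by rewrite big_nil addr0 andbT => /edge_vecE.
case/andP=> /edge_vecE -> /IHs; rewrite big_cons => <-.
by rewrite -!addrA [_ + (_ + vertex_vec q.1)]addrA F2_addvv add0r.
Qed.

Lemma cycle_span (p : V * E) s : graph_cycle (p :: s) ->
  edge_vec p.2 \in <<map edge_vec (unzip2 s)>>%VS.
Proof.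
case/and4P=> _ _ _ /= /walk_vec; rewrite F2_addvv => /esym/eqP.
rewrite addr_eq0 => /eqP ->; rewrite memvN.
rewrite big_seq; apply: memv_suml => e es.
by apply/memv_span/map_f.
Qed.

Lemma free_forest X : X \in free_sets edge_vec -> forest X.
Proof.
move=> fX; apply/forestP => -[|p s] cs //; apply/negP => sX.
have us : uniq (unzip2 (p :: s)) by case/and4P: cs.
have : [set e in unzip2 (p :: s)] \in free_sets edge_vec.
  apply: free_sets_sub fX; apply/subsetP => e; rewrite in_set.
  exact: (allP sX).
rewrite (@free_sets_perm _ _ _ _ _ (unzip2 (p :: s))) //; last first.
  by move=> e; rewrite in_set.
by rewrite /= free_cons cycle_span.
Qed.

Definition adj X x y := [exists e in X, joins e x y].

Lemma path_walk X x p : path (adj X) x p -> uniq (x :: p) ->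
  exists s, [/\ unzip1 s = belast x p, uniq (unzip2 s), all (mem X) (unzip2 s),
    {in s, forall q : V * E, ((ends q.2).1 \in x :: p) && ((ends q.2).2 \in x :: p)}
    & forall f y z, joins f (last x p) y ->
        path (fun p q : V * E => joins p.2 p.1 q.1) z
          (rcons s (last x p, f)) = joins z.2 z.1 x].
Proof.
elim: p x => [|y p IHp] x /=.
  by move=> _ _; exists [::]; split=> //= f y z _; rewrite andbT.
case/andP=> /exists_inP[e eX exy] pyp /andP[xyp uyp].
have [s [s1 us sX se ws]] := IHp y pyp uyp.
exists ((x, e) :: s); split=> /=.
- by rewrite s1.
- rewrite us andbT; apply/mapP => -[q qs /= eq].
  have := se q qs; rewrite -eq => /andP[e1 e2].
  by move: xyp; case/orP: exy e1 e2 => /eqP -> /= e1 e2; rewrite ?e1 ?e2.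
- by rewrite eX.
- move=> q; rewrite inE => /predU1P[-> /=|/se/andP[e1 e2]].
    by case/orP: exy => /eqP -> /=; rewrite !inE !eqxx ?orbT.
  by rewrite !(in_cons _ (y :: p)) e1 e2 !orbT.
by move=> f z q jf; rewrite (ws f z) // exy andbT.
Qed.

Lemma connect_cycle X e : e \notin X ->
  connect (adj X) (ends e).1 (ends e).2 -> ~~ forest (e |: X).
Proof.
move=> eX /connectP[p0 pp0 eq0].
have [p [pp up eqp]] : exists p, [/\ path (adj X) (ends e).1 p,
    uniq ((ends e).1 :: p) & (ends e).2 = last (ends e).1 p].
  by rewrite eq0; have [p pp up _] := shortenP pp0; exists p.
have [s [s1 us sX _ ws]] := path_walk pp up.
have je : joins e (last (ends e).1 p) (ends e).1.
  by rewrite -eqp /joins -surjective_pairing eqxx orbT.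
set c := rcons s (last (ends e).1 p, e).
have c2 : unzip2 c = rcons (unzip2 s) e by rewrite /unzip2 map_rcons.
have aX : all (mem (e |: X)) (unzip2 c).
  rewrite c2 all_rcons /= setU11; apply: sub_all sX => f fX.
  exact: (subsetP (subsetUr _ _)).
have cc : graph_cycle c.
  apply/and4P; split.
  - by rewrite -size_eq0 size_rcons.
  - by rewrite /unzip1 map_rcons -/(unzip1 s) s1 -lastI.
  - rewrite c2 rcons_uniq us andbT; apply: contra eX => es.
    exact: (allP sX).
  by rewrite /c -rot1_cons rot_cycle /= (ws _ (ends e).1).
by apply/negP => /forestP/(_ c cc); rewrite aX.
Qed.

Lemma forest_sub X Y : X \subset Y -> forest Y -> forest X.
Proof.
move=> sXY /forestP fY; apply/forestP => s cs; apply: contra (fY s cs).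
by apply: sub_all => e; apply: (subsetP sXY).
Qed.

Lemma forest_free X : forest X -> X \in free_sets edge_vec.
Proof.
move: {2}#|X| (erefl #|X|) => n; elim: n X => [|n IHn] X.
  by move/eqP; rewrite cards_eq0 => /eqP -> _; apply: free_sets0.
move=> cX fX; have /card_gt0P[e eX] : (0 < #|X|)%N by rewrite cX.
have eX' : e \notin X :\ e by rewrite !inE eqxx.
rewrite -(setD1K eX) free_sets1 //; apply/andP; split; last first.
  apply: IHn; last exact: forest_sub (subD1set _ _) fX.
  by move: cX; rewrite (cardsD1 e) eX => -[].
apply/negP => es.
suff /(connect_cycle eX') : connect (adj (X :\ e)) (ends e).1 (ends e).2.
  by rewrite setD1K // fX.
set C := connect _ _.
pose c : 'cV['F_2]_#|V| := \col_k (C (enum_val k))%:R.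
have phiE x : vertex_vec x *m c = (C x)%:R%:M.
  apply/rowP => i; rewrite /vertex_vec -rowE !mxE enum_rankK ord1.
  by rewrite eqxx mulr1n.
have : (<<[seq edge_vec f | f in X :\ e]>> <= lker (linfun (mulmxr c)))%VS.
  apply/span_subvP => _ /imageP[f fXe ->]; rewrite memv_ker lfunE /=.
  rewrite mulmxDl !phiE; suff -> : C (ends f).1 = C (ends f).2.
    by rewrite F2_addvv.
  have af : adj (X :\ e) (ends f).1 (ends f).2.
    by apply/exists_inP; exists f; rewrite // /joins -surjective_pairing eqxx.
  have af' : adj (X :\ e) (ends f).2 (ends f).1.
    apply/exists_inP; exists f; rewrite // /joins -surjective_pairing.
    by rewrite eqxx orbT.
  by apply/idP/idP => /connect_trans; apply; apply: connect1.
move/subvP/(_ _ es); rewrite memv_ker lfunE /= mulmxDl !phiE {1}/C connect0.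
by case: (C _) => //= /eqP/rowP/(_ 0); rewrite !mxE /= addr0.
Qed.

Definition forests : {set {set E}} := [set X | forest X].

Lemma forestsE : forests = free_sets edge_vec.
Proof.
apply/setP => X; rewrite inE; apply/idP/idP.
  exact: forest_free.
exact: free_forest.
Qed.

Lemma forests0 : set0 \in forests.
Proof. by rewrite forestsE; apply: free_sets0. Qed.

Lemma forests_sub X Y : X \subset Y -> Y \in forests -> X \in forests.
Proof. by rewrite forestsE; apply: free_sets_sub. Qed.

Lemma forests_aug X Y : X \in forests -> Y \in forests -> (#|X| < #|Y|)%N ->
  exists2 e, e \in Y :\: X & e |: X \in forests.
Proof. by rewrite forestsE; apply: free_sets_aug. Qed.

Definition cycle_matroid : matroid E :=
  @Matroid _ [set: E] forests
    (fun X _ => subsetT X) forests0 forests_sub forests_aug.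

End CycleMatroid.

Definition complete_graph (n : nat) : graph :=
  @Graph 'I_n {p : 'I_n * 'I_n | (p.1 < p.2)%N} val.

Definition cographic (T : finType) (M : matroid T) : Prop :=
  exists G : graph, matroid_iso M (dual (cycle_matroid G)).

Definition represents (T : finType) (F : fieldType) (m n : nat)
    (A : 'M[F]_(m, n)) (M : matroid T) : Prop :=
  matroid_iso M (vector_matroid A).

Definition even_cut (T : finType) (M : matroid T) : Prop :=
  exists (m n : nat) (A : 'M['F_2]_(m.+1, n)) (i : 'I_m.+1),
    represents A M /\ cographic (vector_matroid (row' i A)).

Definition H12_rows : seq (seq nat) :=
  [:: [:: 1; 0; 1; 0; 1; 0; 1; 0; 1; 0; 1; 0];
      [:: 0; 0; 0; 0; 1; 1; 1; 1; 0; 0; 0; 0];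
      [:: 0; 0; 0; 0; 1; 1; 0; 0; 1; 1; 0; 0];
      [:: 1; 1; 0; 0; 0; 0; 0; 0; 0; 0; 1; 1];
      [:: 0; 0; 1; 1; 0; 0; 1; 1; 0; 0; 1; 1]]%N.

Definition H12_mx : 'M['F_2]_(5, 12) :=
  \matrix_(i < 5, j < 12) (nth 0%N (nth [::] H12_rows i) j)%:R.

Definition H12 : matroid 'I_12 := vector_matroid H12_mx.

(* Main.v *)
From HB Require Import structures.
Require Import Defs.
From mathcomp Require Import all_boot all_order all_algebra.

(** A binary matroid is handled through its cycle space, a family of sets closed
    under symmetric difference. Dualising takes the orthogonal space and a minor
    M / C \ D has as cycles the sets z \ C for the cycles z of M avoiding D. The
    dual of M(G) has the cuts of G as cycles, so M is even-cut iff its cycle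
    space Z has codimension at most one in the cut space W of some graph, a
    property that is visibly inherited by minors; hence the positive half only
    requires an explicit graph for each single-element deletion and contraction.

    The stars of the vertices of G generate W and cover every element at most
    twice. For M(K6), a member of W outside Z has odd degree at some vertex u of
    K6, so the members of W avoiding the star of u form the cycle space of K5.
    They are the cuts of a contraction of G, and its at least seven nonempty
    stars would each contain three of the ten edges of K5, although 21 > 20. For
    H12*, Z is the row space of H12, and a search through the 128 spaces W that
    contain Z with codimension at most one finds no suitable family of stars. *)

Set Implicit Arguments.
Unset Strict Implicit.
Unset Printing Implicit Defensive.

Import GRing.Theory.
Local Open Scope ring_scope.

(** * Cycle spaces of binary matroids *)

Section BinarySpaces.

Variable T : finType.
Implicit Types (X Y z w E S B C D : {set T}) (Z W : {set {set T}}).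

Definition symd X Y : {set T} := [set x | (x \in X) (+) (x \in Y)].

Lemma in_symd x X Y : (x \in symd X Y) = (x \in X) (+) (x \in Y).
Proof. by rewrite inE. Qed.

Lemma symdC : commutative symd.
Proof. by move=> X Y; apply/setP => x; rewrite !in_symd addbC. Qed.

Lemma symdA : associative symd.
Proof. by move=> X Y z; apply/setP => x; rewrite !in_symd addbA. Qed.

Lemma symd0 X : symd X set0 = X.
Proof. by apply/setP => x; rewrite in_symd inE addbF. Qed.

Lemma sym0d : left_id set0 symd.
Proof. by move=> X; rewrite symdC symd0. Qed.

HB.instance Definition _ := Monoid.isComLaw.Build {set T} set0 symd symdA symdC sym0d.

Lemma symdv X : symd X X = set0.
Proof. by apply/setP => x; rewrite in_symd addbb inE. Qed.

Lemma symdK X Y : symd (symd X Y) Y = X.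
Proof. by rewrite -symdA symdv symd0. Qed.

Lemma symd_subset X Y E : X \subset E -> Y \subset E -> symd X Y \subset E.
Proof.
move=> sX sY; apply/subsetP => x; rewrite in_symd.
by have [/(subsetP sX)//|_ /(subsetP sY)] := boolP (x \in X).
Qed.

(** The standard bilinear form over GF(2) on indicator vectors: the parity of the intersection. *)
Definition dotp X Y : bool := \big[addb/false]_x ((x \in X) && (x \in Y)).

Lemma dotpC X Y : dotp X Y = dotp Y X.
Proof. by apply: eq_bigr => x _; rewrite andbC. Qed.

Lemma dotp_symdl X Y z : dotp (symd X Y) z = dotp X z (+) dotp Y z.
Proof.
by rewrite -big_split; apply: eq_bigr => x _; rewrite in_symd andb_addl.
Qed.

Lemma dotp_symdr X Y z : dotp z (symd X Y) = dotp z X (+) dotp z Y.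
Proof. by rewrite ![dotp z _]dotpC dotp_symdl. Qed.

Lemma dotp0 X : dotp X set0 = false.
Proof. by rewrite /dotp big1 // => x _; rewrite inE andbF. Qed.

Lemma dotp_eqI X X' Y Y' : X :&: Y = X' :&: Y' -> dotp X Y = dotp X' Y'.
Proof.
by move=> eI; apply: eq_bigr => x _; rewrite -!in_setI eI.
Qed.

Lemma dotp_setIr X Y E : X \subset E -> dotp X (Y :&: E) = dotp X Y.
Proof. by move=> /setIidPl eX; apply: dotp_eqI; rewrite setIA setIAC eX. Qed.

Lemma dotp_disjoint X Y : [disjoint X & Y] -> dotp X Y = false.
Proof.
move/disjoint_setI0 => XY; rewrite (@dotp_eqI X set0 Y set0) ?XY ?setI0 //.
exact: dotp0.
Qed.

Lemma dotp1 X f : dotp X [set f] = (f \in X).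
Proof.
rewrite /dotp (bigD1 f) //= set11 andbT big1 ?addbF // => x nx.
by rewrite inE (negbTE nx) andbF.
Qed.

Lemma dotp_single X Y f : X :&: Y = [set f] -> dotp X Y.
Proof.
move=> eI; rewrite (@dotp_eqI X setT Y [set f]) ?setTI // dotp1.
exact: in_setT.
Qed.

Definition binary_space Z :=
  set0 \in Z /\ forall a b, a \in Z -> b \in Z -> symd a b \in Z.

(** The complement is taken inside [E] because a matroid on [T] may have a smaller ground set. *)
Definition perp E Z : {set {set T}} :=
  [set Y : {set T} | (Y \subset E) && [forall z in Z, ~~ dotp Y z]].

Lemma perpP E Z Y :
  reflect (Y \subset E /\ forall z, z \in Z -> dotp Y z = false) (Y \in perp E Z).
Proof.
rewrite inE; apply: (iffP andP) => -[sY pY]; split=> //.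
  by move=> z zZ; apply: negbTE; have /forall_inP := pY; apply.
by apply/forall_inP => z zZ; rewrite pY.
Qed.

Lemma perp_space E Z : binary_space (perp E Z).
Proof.
split=> [|a b /perpP[sa pa] /perpP[sb pb]]; apply/perpP; split.
- exact: sub0set.
- by move=> z _; rewrite dotpC dotp0.
- exact: symd_subset.
by move=> z zZ; rewrite dotp_symdl pa ?pb.
Qed.

Lemma natrF2_addb (a b : bool) : (a (+) b)%:R = a%:R + b%:R :> 'F_2.
Proof. by case: a; case: b => //=; apply/val_inj. Qed.

Lemma natrF2_eq0 (a : bool) : (a%:R == 0 :> 'F_2) = ~~ a.
Proof. by case: a. Qed.

Lemma F2_natr (c : 'F_2) : c = (c != 0)%:R.
Proof.
by case: c => -[|[|//]] i; apply/val_inj.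
Qed.

Lemma natrF2_odd k : (k%:R != 0 :> 'F_2) = odd k.
Proof.
elim: k => // k IHk; rewrite -natr1 /= -IHk.
by have := F2_natr k%:R; case: (_ == 0) => ->.
Qed.

Lemma natrF2_sum (I : finType) (F : I -> bool) :
  (\big[addb/false]_i F i)%:R = \sum_i (F i)%:R :> 'F_2.
Proof. by apply: (big_morph (fun b : bool => b%:R : 'F_2) natrF2_addb). Qed.

Lemma space_big Z (I : Type) (r : seq I) (F : I -> {set T}) :
  binary_space Z -> (forall i, F i \in Z) -> \big[symd/set0]_(i <- r) F i \in Z.
Proof. by case=> Z0 ZD FZ; apply: (big_ind (fun X => X \in Z)) => [|a b aZ bZ|i _] //; apply: ZD. Qed.

(* Rows of a matrix are the elements of Z; its cokernel is spanned by columns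
   that are (indicators of) members of the orthogonal space. *)
Lemma perpK E Z : binary_space Z -> (forall z, z \in Z -> z \subset E) ->
  perp E (perp E Z) = Z.
Proof.
move=> sZ ZE; apply/setP => y; apply/perpP/idP => [[yE py]|yZ]; last first.
  split; first exact: ZE.
  by move=> w /perpP[_ /(_ _ yZ)]; rewrite dotpC.
pose vec X : 'rV['F_2]_#|T| := \row_j (enum_val j \in X)%:R.
pose B : 'M['F_2]_(#|Z|, #|T|) := \matrix_i vec (enum_val i).
have dotE X (c : 'cV['F_2]_#|T|) :
    (vec X *m c) 0 0 = (dotp X [set x | c (enum_rank x) 0 != 0])%:R.
  rewrite mxE /dotp natrF2_sum (reindex_onto enum_rank enum_val) /=; last first.
    by move=> i _; rewrite enum_valK.
  rewrite [LHS](eq_bigl xpredT); last by move=> x; rewrite enum_rankK eqxx.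
  apply: eq_bigr => x _; rewrite !mxE enum_rankK inE.
  rewrite [c _ _ in LHS]F2_natr; case: (x \in X); rewrite ?mul1r ?mul0r //=.
have : (vec y <= B)%MS.
  rewrite submxE; apply/eqP/rowP => j; rewrite [RHS]mxE.
  set c := col j (cokermx B).
  have -> : (vec y *m cokermx B) 0 j = (vec y *m c) 0 0.
    by rewrite !mxE; apply: eq_bigr => i _; rewrite !mxE.
  rewrite dotE; set Y := [set x | _].
  suff: dotp y Y = false by move->.
  have cZ z : z \in Z -> dotp z Y = false.
    move=> zZ; apply: negbTE; rewrite -natrF2_eq0 -dotE; apply/eqP.
    have -> : (vec z *m c) 0 0 = (B *m cokermx B) (enum_rank_in zZ z) j.
      rewrite !mxE; apply: eq_bigr => i _; rewrite !mxE.
      by rewrite enum_rankK_in.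
    by rewrite mulmx_coker mxE.
  (* [Y] may leave [E]; restricting it to [E] changes no product with [y] or with a member of
     [Z]. *)
  rewrite -(dotp_setIr Y yE); apply: py; apply/perpP; split; first exact: subsetIr.
  by move=> z zZ; rewrite dotpC dotp_setIr ?ZE ?cZ.
case/submxP=> D eD.
(* Coefficients over GF(2) are 0 or 1, so the combination of rows is a symmetric difference of
   members of [Z]. *)
suff -> : y = \big[symd/set0]_(i < #|Z|) (if D 0 i != 0 then enum_val i else set0).
  apply: space_big => // i; case: ifP => _; [exact: enum_valP | exact: sZ.1].
apply/setP => x; have /rowP/(_ (enum_rank x)) := eD.
rewrite !mxE enum_rankK => eyx.
have inbig (r : seq 'I_#|Z|) (F : 'I_#|Z| -> {set T}) :
    (x \in \big[symd/set0]_(i <- r) F i) = \big[addb/false]_(i <- r) (x \in F i).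
  by apply: (big_morph (fun X : {set T} => x \in X)) => [X Y|]; rewrite ?in_symd ?inE.
rewrite inbig; apply: negb_inj; rewrite -!natrF2_eq0 eyx natrF2_sum; congr (_ == 0).
apply: eq_bigr => i _; rewrite !mxE enum_rankK [D 0 i in LHS]F2_natr.
by case: (_ != _); rewrite ?mul1r ?mul0r // inE.
Qed.

Definition dependent Z X := [exists z in Z, (z \subset X) && (z != set0)].

Lemma dependentP Z X :
  reflect (exists z, [/\ z \in Z, z \subset X & z != set0]) (dependent Z X).
Proof.
apply: (iffP exists_inP) => [[z zZ /andP[]]|[z [zZ zX z0]]]; exists z => //.
exact/andP.
Qed.

Lemma dependent_mem Z z : z \in Z -> z != set0 -> dependent Z z.
Proof. by move=> zZ z0; apply/dependentP; exists z; split. Qed.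

(** A matroid with such a [Z] is binary, and its circuits are the minimal nonempty members of
    [Z]. *)
Definition cycle_space (M : matroid T) Z :=
  [/\ binary_space Z, forall z, z \in Z -> z \subset ground M
    & forall X, X \subset ground M -> (X \in indep M) = ~~ dependent Z X].

(** Induction on the size of [z]. A minimal dependent subset [C] of [z] contains a nonempty member
    of each space, hence by minimality belongs to both; adding it to [z] gives a smaller member of
    [Z]. *)
Lemma cycle_space_sub M Z Z' :
  cycle_space M Z -> cycle_space M Z' -> Z \subset Z'.
Proof.
move=> hZ hZ'; have [[Z0 ZD] ZE iZ] := hZ; have [[Z'0 Z'D] _ _] := hZ'.
apply/subsetP => z.
elim: {z}_.+1 {-2}z (ltnSn #|z|) => // n IHn z ltzn zZ.
have [->//|z0] := eqVneq z set0.
have dz : z \notin indep M.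
  by rewrite iZ ?ZE // negbK dependent_mem.
have [|C /minsetP[/andP[dC Cz] minC] _] :=
    @minset_exists _ (fun X => (X \notin indep M) && (X \subset z)) z.
  by rewrite dz subxx.
have CE : C \subset ground M := subset_trans Cz (ZE _ zZ).
have circ W : cycle_space M W -> C \in W.
  case=> _ YE iY; move: (dC); rewrite iY // negbK => /dependentP[c [cY cC c0]].
  rewrite -(minC c) // (subset_trans cC Cz) andbT iY ?YE // negbK.
  exact: dependent_mem.
have CZ : C \in Z by exact: circ.
have CZ' : C \in Z' by exact: circ.
rewrite -(symdK z C) Z'D // IHn ?ZD //.
have /set0Pn[x xC] : C != set0 by apply: contraNneq dC => ->; apply: indep0.
rewrite -ltnS; apply: leq_trans ltzn; apply: proper_card; apply/properP; split.
  exact: symd_subset.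
by exists x; rewrite ?in_symd ?xC (subsetP Cz).
Qed.

Lemma cycle_space_uniq M Z Z' : cycle_space M Z -> cycle_space M Z' -> Z = Z'.
Proof.
by move=> h h'; apply/eqP; rewrite eqEsubset !(cycle_space_sub h h', cycle_space_sub h' h).
Qed.

(** Reduction along fundamental cycles: by maximality every [g] of [S] outside [B] lies on a cycle
    inside [g |: B], and adding that cycle to [z] removes [g] without bringing in another element
    outside [B]. *)
Lemma span_max_indep M Z S B z : cycle_space M Z -> S \subset ground M ->
  B \in indep M -> B \subset S ->
  (forall g, g \in S -> g \notin B -> g |: B \notin indep M) -> z \subset S ->
  exists z0, [/\ z0 \in Z, z0 \subset S & symd z z0 \subset B].
Proof.
move=> [[Z0 ZD] ZE iZ] SE iB BS maxB.
elim: {z}_.+1 {-2}z (ltnSn #|z :\: B|) => // n IHn z ltzn zS.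
have [|/set0Pn[g /setDP[gz gB]]] := eqVneq (z :\: B) set0.
  move/eqP; rewrite setD_eq0 => zB; exists set0.
  by rewrite symd0 sub0set.
have gS := subsetP zS _ gz.
have gBS : g |: B \subset S by rewrite subUset sub1set gS.
have := maxB _ gS gB; rewrite iZ ?(subset_trans gBS) // negbK.
case/dependentP=> c [cZ cgB c0].
have cS := subset_trans cgB gBS.
have gc : g \in c.
  apply/negPn/negP => gc; move: iB; rewrite iZ ?(subset_trans BS) // => /negP; apply.
  apply/dependentP; exists c; split=> //; apply/subsetP => x xc.
  have := subsetP cgB _ xc; rewrite in_setU1 => /predU1P[xg|//].
  by rewrite -xg xc in gc.
have [||z0 [z0Z z0S sB]] := IHn (symd z c).
- rewrite -ltnS; apply: leq_trans ltzn; apply: proper_card; apply/properP; split.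
    apply/subsetP => x /setDP[]; rewrite in_symd inE => xzc xB.
    rewrite xB; have [xc|xc] := boolP (x \in c); last by rewrite (negbTE xc) addbF in xzc.
    have := subsetP cgB _ xc; rewrite in_setU1 (negbTE xB) orbF => /eqP ->.
    by rewrite gz.
  by exists g; rewrite !inE gB ?gz ?gc.
- exact: symd_subset.
exists (symd c z0); split; rewrite ?ZD ?symdA //.
exact: symd_subset.
Qed.

(** If a basis [B] avoids [X], a nonempty [y] in [X] orthogonal to [Z] would meet the fundamental
    cycle of any [f] in [y] in [f] alone, an odd intersection. Conversely, a maximal independent
    subset [B] of the complement [S] of [X] is a basis: each singleton of [X] is the trace on [X] of
    some cycle, so no element of [X] extends [B]. *)
Lemma dual_cycle_space M Z :
  cycle_space M Z -> cycle_space (dual M) (perp (ground M) Z).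
Proof.
move=> cZ; have [[Z0 ZD] ZE iZ] := cZ; split; first exact: perp_space.
  by move=> z /perpP[].
move=> X /= XE; apply/dual_indepP/idP => [[B bB XB]|indX].
  apply/negP => /dependentP[y [/perpP[yE py] yX /set0Pn[f fy]]].
  have := subsetP XB _ (subsetP yX _ fy); rewrite inE => /andP[fB fE].
  have iB := bases_indep bB.
  have fBE : f |: B \subset ground M by rewrite subUset sub1set fE indep_ground.
  have : f |: B \notin indep M.
    move: bB; rewrite inE => /maxsetP[_ maxB]; apply/negP => ifB; case/negP: fB.
    by rewrite -(maxB _ ifB (subsetUr _ _)) setU11.
  rewrite iZ // negbK => /dependentP[c [cZ' cfB c0]].
  have fc : f \in c.
    apply/negPn/negP => fc; move: (iB); rewrite iZ ?indep_ground // => /negP; apply.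
    apply/dependentP; exists c; split=> //; apply/subsetP => x xc.
    have := subsetP cfB _ xc; rewrite in_setU1 => /predU1P[xf|//].
    by rewrite -xf xc in fc.
  have /dotp_single : y :&: c = [set f].
    apply/setP => x; rewrite !inE; apply/andP/eqP => [[xy xc]|->//].
    have := subsetP cfB _ xc; rewrite in_setU1 => /predU1P[//|xB].
    by have := subsetP XB _ (subsetP yX _ xy); rewrite inE xB.
  by rewrite py.
pose S := ground M :\: X.
have [|B /maxsetP[/andP[iB BS] maxB] _] :=
    @maxset_exists _ (fun B => (B \in indep M) && (B \subset S)) set0.
  by rewrite indep0 sub0set.
exists B; last first.
  apply/subsetP => x xX; rewrite inE (subsetP XE) // andbT.
  by apply/negP => /(subsetP BS); rewrite inE xX.
have SE : S \subset ground M by apply: subsetDl.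
have maxB' g : g \in S -> g \notin B -> g |: B \notin indep M.
  move=> gS gB; apply/negP => igB; move: gB.
  by rewrite -(maxB (g |: B)) ?subsetUr ?setU11 // igB subUset sub1set gS.
rewrite inE; apply/maxsetP; split=> // Y iY BY; apply/eqP.
rewrite eqEsubset BY andbT; apply/subsetP => g gY; apply/negPn/negP => gB.
have igB : g |: B \in indep M by apply: indep_sub iY; rewrite subUset sub1set gY.
have gE := subsetP (indep_ground iY) _ gY.
have [gS|gS] := boolP (g \in S); first by rewrite (negbTE (maxB' _ gS gB)) in igB.
have gX : g \in X by move: gS; rewrite inE gE andbT negbK.
(* The traces of cycles on [X]. A subset of [X] orthogonal to all of them is orthogonal to [Z],
   hence empty, so by [perpK] every subset of [X] is a trace, in particular [[set g]]. *)
pose ZX := [set z :&: X | z in Z].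
have sZX : binary_space ZX.
  split; first by apply/imsetP; exists set0; rewrite ?set0I.
  move=> _ _ /imsetP[a aZ ->] /imsetP[b bZ ->]; apply/imsetP; exists (symd a b).
    exact: ZD.
  by apply/setP => x; rewrite !inE; case: (x \in X); rewrite ?andbT ?andbF.
have : [set g] \in ZX.
  rewrite -(@perpK X ZX) //; last by move=> _ /imsetP[z _ ->]; apply: subsetIr.
  apply/perpP; split; first by rewrite sub1set.
  move=> y /perpP[yX py]; suff -> : y = set0 by rewrite dotp0.
  apply/eqP/negPn/negP => y0; case/negP: indX; apply/dependentP; exists y; split=> //.
  apply/perpP; split; first exact: subset_trans XE.
  by move=> z zZ; rewrite -(dotp_setIr z yX) py //; apply/imsetP; exists z.
case/imsetP=> z zZ ez.
have gz : g \in z by have := set11 g; rewrite ez inE => /andP[].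
have zgS : z :\ g \subset S.
  apply/subsetP => x; rewrite !inE => /andP[xg xz]; rewrite (subsetP (ZE _ zZ)) // andbT.
  apply/negP => xX; case/eqP: xg; apply/set1P; rewrite ez inE xz.
  exact: xX.
(* [z] meets [X] in [g] only; reducing the rest modulo cycles inside [S] leaves a cycle inside
   [g |: B], against its independence. *)
have [z0 [z0Z z0S zB]] := span_max_indep cZ SE iB BS maxB' zgS.
move: igB; rewrite iZ; last by rewrite subUset sub1set gE (subset_trans BS).
move/negP; apply; apply/dependentP; exists (symd z z0); split; first exact: ZD.
  apply/subsetP => x; rewrite in_symd in_setU1; have [//|xg] := eqVneq x g.
  by move=> xzz; apply: (subsetP zB); rewrite !inE xg.
apply/set0Pn; exists g; rewrite in_symd gz.
by apply/negP => /(subsetP z0S); rewrite (negbTE gS).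
Qed.

Lemma delete_cycle_space M Z D : cycle_space M Z ->
  cycle_space (delete M D) [set z in Z | [disjoint z & D]].
Proof.
move=> [[Z0 ZD] ZE iZ]; split.
- split=> [|a b]; first by rewrite inE Z0 disjoints_subset sub0set.
  rewrite !inE !disjoints_subset => /andP[aZ aD] /andP[bZ bD].
  by rewrite ZD // symd_subset.
- by move=> z; rewrite inE => /andP[zZ zD]; rewrite /= subsetD zD ZE.
move=> X /= XE; rewrite inE XE andbT; move: (XE).
rewrite subsetD => /andP[XM XD]; rewrite iZ //; congr (~~ _).
apply/dependentP/dependentP => -[z [zZ zX z0]]; exists z; split=> //.
  by rewrite inE zZ (disjointWl zX).
by move: zZ; rewrite inE => /andP[].
Qed.

(** Contraction is deletion in the dual, so its cycle space is the orthogonal space of the cocycles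
    avoiding [C]. These are exactly the sets orthogonal to all [z :\: C], and [perpK] undoes the
    complement. *)
Lemma contract_cycle_space M Z C : cycle_space M Z ->
  cycle_space (contract M C) [set z :\: C | z in Z].
Proof.
move=> cZ; have [[Z0 ZD] ZE iZ] := cZ.
have := dual_cycle_space (delete_cycle_space C (dual_cycle_space cZ)).
rewrite -/(contract M C) /=; set Z' := [set _ | z in Z].
have sZ' : binary_space Z'.
  split; first by apply/imsetP; exists set0; rewrite ?set0D.
  move=> _ _ /imsetP[a aZ ->] /imsetP[b bZ ->]; apply/imsetP; exists (symd a b).
    exact: ZD.
  by apply/setP => x; rewrite !inE; case: (x \in C).
suff -> : [set z in perp (ground M) Z | [disjoint z & C]] = perp (ground M :\: C) Z'.
  by rewrite perpK // => _ /imsetP[z zZ ->]; apply/setSD/ZE.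
have eqd w z : [disjoint w & C] -> dotp w z = dotp w (z :\: C).
  move=> wC; apply: dotp_eqI; rewrite setDE setICA setIC; congr (_ :&: _).
  by apply/esym/setIidPl; rewrite -disjoints_subset.
apply/setP => w; rewrite inE; apply/andP/perpP => [[/perpP[wE pw] wC]|].
  split; first by rewrite subsetD wE.
  by move=> _ /imsetP[z zZ ->]; rewrite -eqd // pw.
rewrite subsetD => -[/andP[wE wC] pw]; split=> //.
by apply/perpP; split=> // z zZ; rewrite eqd // pw //; apply/imsetP; exists z.
Qed.

Lemma minor_cycle_space M Z C D : cycle_space M Z ->
  cycle_space (contract (delete M D) C)
    [set z :\: C | z in [set z in Z | [disjoint z & D]]].
Proof. by move=> cZ; apply/contract_cycle_space/delete_cycle_space. Qed.

End BinarySpaces.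

Lemma imset_symd (T U : finType) (g : U -> T) (X Y : {set U}) : injective g ->
  g @: symd X Y = symd (g @: X) (g @: Y).
Proof.
move=> gI; apply/setP => t; apply/imsetP/idP => [[u uXY ->]|].
  by rewrite in_symd !(mem_imset _ _ gI) -in_symd.
rewrite in_symd; have [/imsetP[u uX ->]|nX] := boolP (t \in g @: X).
  by rewrite (mem_imset _ _ gI) => uY; exists u; rewrite // in_symd uX.
move=> /imsetP[u uY et]; exists u => //; rewrite in_symd uY.
by move: nX; rewrite et (mem_imset _ _ gI) => /negbTE ->.
Qed.

(** * Linear dependence over GF(2) *)

Section FreeCycleSpace.

Variables (vT : vectType 'F_2) (T : finType) (v : T -> vT).
Implicit Types X Y : {set T}.

(** Coefficients over GF(2) are indicators, so these sets are all the linear relations among the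
    vectors [v t]. *)
Definition zero_sums : {set {set T}} := [set Y : {set T} | \sum_(y in Y) v y == 0].

Lemma sum_setE Y : \sum_(y in Y) v y = \sum_y ((y \in Y)%:R : 'F_2) *: v y.
Proof.
rewrite big_mkcond; apply: eq_bigr => y _.
by case: (y \in Y); rewrite ?scale1r ?scale0r.
Qed.

Lemma sum_symd X Y :
  \sum_(y in symd X Y) v y = \sum_(y in X) v y + \sum_(y in Y) v y.
Proof.
rewrite !sum_setE -big_split; apply: eq_bigr => y _ /=.
by rewrite in_symd natrF2_addb scalerDl.
Qed.

Lemma zero_sums_space : binary_space zero_sums.
Proof.
split=> [|a b]; first by rewrite inE big_set0.
by rewrite !inE sum_symd => /eqP -> /eqP ->; rewrite addr0.
Qed.

Lemma span_sum_set (s : seq T) (w : vT) : w \in <<map v s>>%VS ->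
  exists2 Y : {set T}, {subset Y <= s} & w = \sum_(y in Y) v y.
Proof.
elim: s w => [|x s IHs] w /=.
  rewrite span_nil memv0 => /eqP ->; exists set0; rewrite ?big_set0 //.
  by move=> y; rewrite inE.
rewrite span_cons => /memv_addP[_ /vlineP[c ->] [u /IHs[Y Ys ->] ->]].
have sYx : {subset symd [set x] Y <= x :: s}.
  move=> y; rewrite in_symd !inE.
  by have [->//|_ /Ys ->] := eqVneq y x; rewrite ?orbT.
have [c0|c0] := eqVneq c 0.
  by exists Y => [y /Ys ys|]; rewrite ?c0 ?scale0r ?add0r // inE ys orbT.
by exists (symd [set x] Y); rewrite // sum_symd big_set1 (F2_natr c) c0 scale1r.
Qed.

Lemma free_setsE X : (X \in free_sets v) = ~~ dependent zero_sums X.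
Proof.
apply/idP/negP => [fX /dependentP[Y [Y0 YX /set0Pn[y yY]]]|].
  have := free_sets_sub YX fX; rewrite -(setD1K yY) free_sets1 ?setD11 //.
  case/andP=> /negP[]; move: Y0; rewrite inE (big_setD1 y) //= addr_eq0 => /eqP ->.
  rewrite -memvN opprK; apply: memv_suml => x xY.
  by apply/memv_span/imageP; exists x.
elim: {X}_.+1 {-2}X (ltnSn #|X|) => // n IHn X ltXn iX.
have [->|/set0Pn[e eX]] := eqVneq X set0; first exact: free_sets0.
rewrite -(setD1K eX) free_sets1 ?setD11 //; apply/andP; split; last first.
  apply: IHn => [|/dependentP[Y [YZ YX Y0]]].
    by move: ltXn; rewrite (cardsD1 e) eX.
  by case: iX; apply/dependentP; exists Y; rewrite (subset_trans YX) ?subD1set.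
apply/negP => /span_sum_set[Y Ys eY]; case: iX; apply/dependentP.
have YX : Y \subset X :\ e by apply/subsetP => y /Ys; rewrite mem_enum.
have eNY : e \notin Y by apply/negP => /(subsetP YX); rewrite setD11.
exists (e |: Y); split; last by apply/set0Pn; exists e; rewrite setU11.
- have -> : e |: Y = symd [set e] Y.
    apply/setP => x; rewrite !inE; by have [->|] := eqVneq x e.
  rewrite inE sum_symd big_set1 eY -sum_symd symdv big_set0 //.
- by rewrite subUset sub1set eX (subset_trans YX) ?subD1set.
Qed.

End FreeCycleSpace.

(** * Cuts of a graph given by the two ends of each element *)

Section Cuts.

Variables (T V : finType) (p : T -> V * V).
Implicit Types A B : {set V}.

Definition coboundary A : {set T} := [set t | ((p t).1 \in A) (+) ((p t).2 \in A)].

Definition cuts : {set {set T}} := [set coboundary A | A : {set V}].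

Lemma cutsP w : reflect (exists A, w = coboundary A) (w \in cuts).
Proof. by apply: (iffP imsetP) => [[A _ ->]|[A ->]]; exists A. Qed.

Lemma coboundary_symd A B :
  coboundary (symd A B) = symd (coboundary A) (coboundary B).
Proof. by apply/setP => t; rewrite !inE addbACA. Qed.

Lemma cuts_space : binary_space cuts.
Proof.
split; first by apply/cutsP; exists set0; apply/setP => t; rewrite !inE.
move=> _ _ /cutsP[A ->] /cutsP[B ->]; apply/cutsP.
by exists (symd A B); rewrite coboundary_symd.
Qed.

(** [coboundary] is additive in the vertex set, so vertex stars generate the cut space. *)
Lemma coboundaryE A : coboundary A = \big[@symd T/set0]_(x in A) coboundary [set x].
Proof.
have [n] := ubnP #|A|; elim: n A => // n IHn A ltAn.
have [->|/set0Pn[x xA]] := eqVneq A set0.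
  by rewrite big_set0; apply/setP => t; rewrite !inE.
rewrite (big_setD1 x) //= -IHn; last by move: ltAn; rewrite (cardsD1 x) xA.
rewrite -coboundary_symd; congr coboundary; apply/setP => y; rewrite !inE.
by have [->|] := eqVneq y x; rewrite ?xA.
Qed.

(** Testing the generating stars suffices: the sets orthogonal to all cuts are those with even
    degree at every vertex. *)
Lemma perp_cutsP Y :
  reflect (forall x, dotp Y (coboundary [set x]) = false) (Y \in perp setT cuts).
Proof.
apply: (iffP (perpP _ _ _)) => [[_ pY] x|pY].
  by apply: pY; apply/cutsP; exists [set x].
split=> [|_ /cutsP[A ->]]; first exact: subsetT.
rewrite coboundaryE; apply: (big_ind (fun w => dotp Y w = false)) => //.
  exact: dotp0.
by move=> a b pa pb; rewrite dotp_symdr pa pb.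
Qed.

End Cuts.

Lemma cycle_matroid_cycle_space (G : graph) :
  cycle_space (cycle_matroid G) (perp setT (cuts (@ends G))).
Proof.
suff -> : perp setT (cuts (@ends G)) = zero_sums (@edge_vec G).
  split=> [|z _|X _]; first exact: zero_sums_space.
    exact: subsetT.
  by rewrite /= forestsE free_setsE.
(* The coordinate at [x] of a sum of edge vectors is the parity of the degree of [x] in [Y]. *)
have coordE (Y : {set edge G}) x : (\sum_(y in Y) edge_vec y) 0 (enum_rank x)
    = (dotp Y (coboundary (@ends G) [set x]))%:R.
  rewrite sum_setE summxE natrF2_sum; apply: eq_bigr => e _.
  rewrite !mxE !(inj_eq enum_rank_inj) !inE ![x == _]eq_sym !eqxx /= -natrF2_addb.
  by case: (e \in Y); rewrite ?mul1r ?mul0r.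
apply/setP => Y; rewrite [RHS]inE; apply/perp_cutsP/eqP => [pY|sY x].
  by apply/rowP => j; rewrite -(enum_valK j) coordE pY mxE.
by apply: negbTE; rewrite -natrF2_eq0 -coordE sY mxE.
Qed.

Lemma dual_cycle_matroid_cycle_space (G : graph) :
  cycle_space (dual (cycle_matroid G)) (cuts (@ends G)).
Proof.
have := dual_cycle_space (cycle_matroid_cycle_space G).
by rewrite perpK //; [exact: cuts_space | move=> z _; exact: subsetT].
Qed.

Definition row_supports (m n : nat) (A : 'M['F_2]_(m, n)) : {set {set 'I_n}} :=
  [set [set j | A i j != 0] | i : 'I_m].

Lemma vector_matroid_cycle_space (m n : nat) (A : 'M['F_2]_(m, n)) :
  cycle_space (vector_matroid A) (perp setT (row_supports A)).
Proof.
suff -> : perp setT (row_supports A) = zero_sums (fun j => col j A).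
  split=> [|z _|X _]; first exact: zero_sums_space.
    exact: subsetT.
  by rewrite /= free_setsE.
have coordE (Y : {set 'I_n}) i : (\sum_(j in Y) col j A) i 0 = (dotp Y [set j | A i j != 0])%:R.
  rewrite sum_setE summxE natrF2_sum; apply: eq_bigr => j _.
  rewrite !mxE inE [A i j in LHS]F2_natr.
  by case: (j \in Y); rewrite ?mul1r ?mul0r.
apply/setP => Y; rewrite [RHS]inE; apply/perpP/eqP => [[_ pY]|sY].
  by apply/colP => i; rewrite coordE pY ?mxE //; apply/imsetP; exists i.
split=> [|_ /imsetP[i _ ->]]; first exact: subsetT.
by apply: negbTE; rewrite -natrF2_eq0 -coordE sY mxE.
Qed.

(** * Isomorphisms, and even-cut matroids in terms of cycle spaces *)

Lemma dependent_imset (T U : finType) (g : U -> T) (Z : {set {set T}}) (X : {set U}) :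
  injective g -> dependent [set Y : {set U} | g @: Y \in Z] X = dependent Z (g @: X).
Proof.
move=> gI; apply/dependentP/dependentP => [[Y []]|[z [zZ zX z0]]].
  rewrite inE => YZ YX Y0; exists (g @: Y); rewrite imsetS //; split=> //.
  by rewrite imset_eq0.
have ez : g @: (g @^-1: z) = z.
  apply/setP => t; apply/imsetP/idP => [[u]|tz]; first by rewrite inE => uz ->.
  by have /imsetP[u uX et] := subsetP zX _ tz; exists u; rewrite // inE -et.
exists (g @^-1: z); split; first by rewrite inE ez.
  apply/subsetP => u; rewrite inE => /(subsetP zX).
  by rewrite mem_imset.
by rewrite -(imset_eq0 g) ez.
Qed.

Lemma matroid_iso_of_inj (T U : finType) (M : matroid T) (N : matroid U) (g : U -> T) :
  injective g -> ground N = setT -> ground M = g @: setT ->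
  (forall X : {set U}, (X \in indep N) = (g @: X \in indep M)) -> matroid_iso M N.
Proof.
move=> gI gN gM iNM.
have gP (y : {y : U | y \in ground N}) : g (val y) \in ground M.
  by rewrite gM imset_f // in_setT.
pose h (y : {y : U | y \in ground N}) : {x : T | x \in ground M} :=
  exist _ (g (val y)) (gP y).
have hI : injective h by move=> y y' [/gI/val_inj].
have [|f hK fK] := inj_card_bij hI.
  by rewrite !card_sig (eq_card (B := ground M)) ?gM ?card_imset ?(eq_card (B := ground N)) ?gN.
exists f; split; first by exists h.
move=> X; rewrite iNM; suff -> : g @: (val @: (f @: X)) = val @: X by [].
by rewrite -!imset_comp; apply: eq_imset => x; rewrite /= -[x in RHS]fK.
Qed.

Lemma matroid_iso_bij (T U : finType) (M : matroid T) (N : matroid U) :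
  ground M = setT -> ground N = setT -> matroid_iso M N ->
  exists2 h : T -> U, bijective h &
    forall X : {set T}, (X \in indep M) = (h @: X \in indep N).
Proof.
move=> gM gN [f [[f' fK f'K] iMN]].
have tM x : x \in ground M by rewrite gM.
have tN y : y \in ground N by rewrite gN.
pose h x := val (f (exist _ x (tM x))).
exists h.
  exists (fun y => val (f' (exist _ y (tN y)))) => x; rewrite /h.
    by rewrite (_ : exist _ _ _ = f (exist _ x (tM x))) ?fK //; apply/val_inj.
  by rewrite (_ : exist _ _ _ = f' (exist _ x (tN x))) ?f'K //; apply/val_inj.
move=> X; have := iMN [set x | val x \in X].
have -> : [set val x | x in [set x : {x : T | x \in ground M} | val x \in X]] = X.
  apply/setP => x; apply/imsetP/idP => [[y]|xX]; first by rewrite inE => yX ->.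
  by exists (exist _ x (tM x)); rewrite ?inE.
move=> ->; suff -> : val @: (f @: [set x | val x \in X]) = h @: X by [].
apply/setP => y; apply/imsetP/imsetP.
  move=> [_ /imsetP[x /[!inE] xX ->] ->]; exists (val x) => //.
  by rewrite /h; congr (val (f _)); apply/val_inj.
move=> [x xX ->]; exists (f (exist _ x (tM x))) => //.
by apply/imsetP; exists (exist _ x (tM x)); rewrite ?inE.
Qed.

Lemma iso_cycle_space (T U : finType) (M : matroid T) (N : matroid U) (h : T -> U) Z :
  injective h -> ground M = setT -> ground N = setT ->
  (forall X : {set T}, (X \in indep M) = (h @: X \in indep N)) ->
  cycle_space N Z -> cycle_space M [set X : {set T} | h @: X \in Z].
Proof.
move=> hI gM gN iMN [[Z0 ZD] _ iZ]; split.
- split=> [|a b]; first by rewrite inE imset0.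
  by rewrite !inE imset_symd //; apply: ZD.
- by move=> z _; rewrite gM subsetT.
by move=> X _; rewrite iMN iZ ?gN ?subsetT // dependent_imset.
Qed.

(* The even cuts of a signed graph, up to the choice of the signature: a binary
   space of codimension at most one in the cut space of a graph. *)
Definition even_cut_space (T : finType) (Z : {set {set T}}) : Prop :=
  exists (V : finType) (p : T -> V * V), Z \subset cuts p /\
    forall a b, a \in cuts p -> b \in cuts p ->
      [\/ a \in Z, b \in Z | symd a b \in Z].

(** Without row [i] the cycle space is the cut space of a graph, up to the bijections [h] and [k].
    Restoring the row adds the single condition of orthogonality to its support [r], so the
    codimension is at most one. *)
Lemma even_cut_matroid_space (T : finType) (M : matroid T) Z :
  ground M = setT -> cycle_space M Z -> even_cut M -> even_cut_space Z.
Proof.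
move=> gM cZ [m [n [A [i [isoA [G isoG]]]]]].
have gA : ground (vector_matroid A) = setT by [].
have gA' : ground (vector_matroid (row' i A)) = setT by [].
have gG : ground (dual (cycle_matroid G)) = setT by [].
have [h hB ih] := matroid_iso_bij gM gA isoA.
have [k kB ik] := matroid_iso_bij gA' gG isoG.
have hI := bij_inj hB; have kI := bij_inj kB.
have eZ := cycle_space_uniq cZ
  (iso_cycle_space hI gM gA ih (vector_matroid_cycle_space A)).
have eW := cycle_space_uniq (vector_matroid_cycle_space (row' i A))
  (iso_cycle_space kI gA' gG ik (dual_cycle_matroid_cycle_space G)).
exists (vertex G), (fun t => ends (k (h t))).
set p := fun t => _; pose r := [set j | A i j != 0].
have cutE X : (X \in cuts p) = (h @: X \in perp setT (row_supports (row' i A))).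
  rewrite eW inE; apply/cutsP/cutsP => -[B eB]; exists B.
    apply/setP => e; have [kh khK hkK] : bijective (k \o h) by apply: bij_comp.
    rewrite -(hkK e) /= !(mem_imset _ _ kI) !(mem_imset _ _ hI) eB !inE.
    by [].
  apply/setP => t; rewrite -(mem_imset X t hI) -(mem_imset _ _ kI) eB !inE.
  by [].
have ZE X : (X \in Z) = (X \in cuts p) && ~~ dotp (h @: X) r.
  rewrite cutE eZ inE; apply/perpP/andP => [[_ pX]|[/perpP[_ pX] pr]]; split.
  - apply/perpP; split=> [|_ /imsetP[j _ ->]]; first exact: subsetT.
    apply: pX; apply/imsetP; exists (lift i j) => //.
    by apply/setP => l; rewrite !inE mxE.
  - by rewrite pX //; apply/imsetP; exists i.
  - exact: subsetT.
  move=> _ /imsetP[j _ ->]; have [->|ij] := eqVneq j i; first exact: negbTE.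
  have [j' ej] : exists j', j = lift i j'.
    by case: (unliftP i j) => [j' ->|eij]; [exists j' | rewrite eij eqxx in ij].
  apply: pX; apply/imsetP; exists j' => //.
  by apply/setP => l; rewrite !inE mxE ej.
split; first by apply/subsetP => X; rewrite ZE => /andP[].
move=> a b ca cb; have [_ cD] := cuts_space p.
have := cD _ _ ca cb => cab.
rewrite !ZE ca cb cab /= imset_symd // dotp_symdl.
by case: (dotp _ _); case: (dotp _ _); [constructor 3| constructor 2|constructor 1|constructor 1].
Qed.

(** The matrix has as row [ord0] a functional [s] that cuts [Z] out of the cut space, and its other
    rows span the orthogonal space of the cuts. *)
Lemma even_cut_of_space (T : finType) (M : matroid T) Z :
  cycle_space M Z -> even_cut_space Z -> even_cut M.
Proof.
move=> cZ [V [p [Zp codim]]]; have [[Z0 ZD] ZE iZ] := cZ.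
set n := #|ground M|; pose g : 'I_n -> T := enum_val.
have gI : injective g by apply: enum_val_inj.
have gE : ground M = g @: setT.
  apply/setP => t; apply/idP/imsetP => [tE|[j _ ->]]; last exact: enum_valP.
  by exists (enum_rank_in tE t); rewrite // /g enum_rankK_in.
have gK (X : {set T}) : X \subset ground M -> g @: (g @^-1: X) = X.
  move=> XE; apply/setP => t; apply/imsetP/idP => [[j]|tX]; first by rewrite inE => ? ->.
  have := subsetP XE _ tX; rewrite gE => /imsetP[j _ et]; exists j => //.
  by rewrite inE -et.
pose Z' := [set X : {set 'I_n} | g @: X \in Z].
pose q j := p (g j); pose W := cuts q.
have qE B : coboundary q B = g @^-1: coboundary p B by apply/setP => j; rewrite !inE.
have sZ' : binary_space Z'.
  split=> [|a b]; first by rewrite inE imset0.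
  by rewrite !inE imset_symd //; apply: ZD.
have ZZ' X : X \in Z -> g @^-1: X \in Z' by move=> XZ; rewrite inE gK // ZE.
have ZW : Z' \subset W.
  apply/subsetP => X; rewrite inE => /(subsetP Zp)/cutsP[B eB]; apply/cutsP; exists B.
  by rewrite qE -eB; apply/setP => j; rewrite inE mem_imset.
have codim' a b : a \in W -> b \in W -> [\/ a \in Z', b \in Z' | symd a b \in Z'].
  move=> /cutsP[A ->] /cutsP[B ->].
  have [||/ZZ'|/ZZ'|/ZZ'] := codim (coboundary p A) (coboundary p B).
  - by apply/cutsP; exists A.
  - by apply/cutsP; exists B.
  - by rewrite -qE; constructor 1.
  - by rewrite -qE; constructor 2.
  by rewrite -coboundary_symd -qE coboundary_symd; constructor 3.
(* By [perpK] a cut [a0] outside [Z'] is detected by some [s] orthogonal to [Z']. A cut orthogonal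
   to [s] is then in [Z'], since its sum with [a0] is not. *)
have [s sP] : exists s, forall a, a \in W -> (a \in Z') = ~~ dotp a s.
  have [WZ|/subsetPn[a0 a0W a0Z]] := boolP (W \subset Z').
    by exists set0 => a /(subsetP WZ) ->; rewrite dotp0.
  have pp : perp setT (perp setT Z') = Z' by rewrite perpK // => *; apply: subsetT.
  have : a0 \notin perp setT (perp setT Z') by rewrite pp.
  rewrite inE subsetT /= => /forall_inPn[s /perpP[_ sP]].
  rewrite negbK => a0s; exists s => a aW; apply/idP/idP => [aZ|nas].
    by rewrite dotpC sP.
  case: (codim' _ _ aW a0W) => // [a0Z'|/sP]; first by rewrite a0Z' in a0Z.
  by rewrite dotpC dotp_symdl a0s (negbTE nas).
have sW : binary_space W by apply: cuts_space.
have ppW : perp setT (perp setT W) = W by rewrite perpK // => *; apply: subsetT.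
(* One row for every subset of ['I_n], zeroed unless the subset is orthogonal to [W], avoids the
   choice of a basis. *)
pose m := #|{: {set 'I_n}}|.
pose rw (k : 'I_m) : {set 'I_n} := if enum_val k \in perp setT W then enum_val k else set0.
pose A : 'M['F_2]_(m.+1, n) :=
  \matrix_(i, j) (j \in if unlift ord0 i is Some k then rw k else s)%:R.
have rowA i : [set j | A i j != 0] = if unlift ord0 i is Some k then rw k else s.
  by apply/setP => j; rewrite inE mxE natrF2_eq0 negbK; case: unlift.
have rowA' k : [set j | row' ord0 A k j != 0] = rw k.
  by rewrite -[RHS]/(if Some k is Some k then rw k else s) -(liftK ord0) -rowA;
     apply/setP => j; rewrite !inE mxE.
have perpA' : perp setT (row_supports (row' ord0 A)) = W.
  rewrite -ppW; apply/setP => X; apply/perpP/perpP => -[_ pX]; split; try exact: subsetT.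
    move=> w wW; apply: pX; apply/imsetP; exists (enum_rank w) => //.
    by rewrite rowA' /rw enum_rankK wW.
  move=> _ /imsetP[k _ ->]; rewrite rowA' /rw; case: ifP => [|_]; first exact: pX.
  exact: dotp0.
have perpA : perp setT (row_supports A) = Z'.
  apply/setP => X; apply/perpP/idP => [[_ pX]|XZ].
    have XW : X \in W.
      rewrite -perpA'; apply/perpP; split=> [|_ /imsetP[k _ ->]]; first exact: subsetT.
      by rewrite rowA'; apply: pX; apply/imsetP; exists (lift ord0 k); rewrite ?rowA ?liftK.
    by rewrite sP // pX //; apply/imsetP; exists ord0; rewrite // rowA unlift_none.
  have XW := subsetP ZW _ XZ; split=> [|_ /imsetP[i _ ->]]; first exact: subsetT.
  rewrite rowA; case: (unliftP ord0 i) => [k _|_]; last first.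
    by apply: negbTE; rewrite -sP.
  by move: XW; rewrite -perpA' => /perpP[_]; apply; apply/imsetP; exists k.
exists m, n, A, ord0; split.
  apply: (matroid_iso_of_inj gI) => //.
  have [_ _ iA] := vector_matroid_cycle_space A => X.
  rewrite iA ?subsetT // perpA iZ; last by rewrite gE imsetS ?subsetT.
  by rewrite dependent_imset.
exists (@Graph V 'I_n q).
apply: (@matroid_iso_of_inj _ _ _ _ id) => // [|X]; first by rewrite imset_id.
have [_ _ iA] := vector_matroid_cycle_space (row' ord0 A).
have [_ _ iG] := dual_cycle_matroid_cycle_space (@Graph V 'I_n q).
by rewrite imset_id iA ?subsetT // iG ?subsetT // perpA'.
Qed.

(** For cut spaces, deleting [D] contracts it in the graph and contracting [C] deletes it there. The
    vertex type is kept: each end moves to the root of its component under the elements of [D], and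
    the elements of [C :|: D] become loops, which lie in no cut. *)
Lemma cuts_minor (T V : finType) (p : T -> V * V) (C D : {set T}) :
  exists q : T -> V * V, forall w,
    w \in cuts q <-> exists a, [/\ a \in cuts p, [disjoint a & D] & w = a :\: C].
Proof.
pose e := [rel x y | [exists t in D, ((p t).1 == x) && ((p t).2 == y)
                                  || ((p t).1 == y) && ((p t).2 == x)]].
have eC : connect_sym e.
  by apply: sym_connect_sym => x y /=; apply: eq_existsb => t; rewrite orbC.
exists (fun t => let u := fingraph.root e (p t).1 in
  (u, if t \in C :|: D then u else fingraph.root e (p t).2)) => w.
set q := fun t => _.
have rootD t : t \in D -> fingraph.root e (p t).1 = fingraph.root e (p t).2.
  move=> tD; apply/eqP; rewrite root_connect //; apply: connect1.
  by apply/exists_inP; exists t; rewrite // !eqxx.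
split=> [/cutsP[A ->]|[_ [/cutsP[A ->] dA ->]]].
  exists (coboundary p [set x | fingraph.root e x \in A]); split.
  - by apply/cutsP; eexists.
  - rewrite disjoint_sym disjoints_subset; apply/subsetP => t tD.
    by rewrite !inE rootD ?addbb.
  apply/setP => t; rewrite !inE /q /= inE; case: (t \in C) => /=; first by rewrite addbb.
  by case: ifP => // tD; rewrite rootD.
(* No element of [D] crosses a cut avoiding [D], so its side [A] is a union of components and
   contains a vertex exactly when it contains the root. *)
apply/cutsP; exists A; have cA : closed e (mem A).
  move=> x y /exists_inP[t tD]; move: dA; rewrite disjoint_sym disjoints_subset.
  move/subsetP/(_ _ tD); rewrite !inE negb_add => /eqP eA.
  by case/orP=> /andP[/eqP <- /eqP <-].
have rA x : (fingraph.root e x \in A) = (x \in A).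
  by apply/esym/(closed_connect cA); apply: connect_root.
apply/setP => t; rewrite !inE /q /= inE rA; case: (t \in C) => /=; first by rewrite rA addbb.
case: ifP => tD; rewrite rA // addbb; move: dA; rewrite disjoint_sym disjoints_subset.
by move/subsetP/(_ _ tD); rewrite !inE => /negbTE.
Qed.

Lemma even_cut_space_minor (T : finType) (Z : {set {set T}}) (C D : {set T}) :
  even_cut_space Z ->
  even_cut_space [set z :\: C | z in [set z in Z | [disjoint z & D]]].
Proof.
move=> [V [p [Zp codim]]]; have [q cutq] := cuts_minor p C D.
exists V, q; split.
  apply/subsetP => _ /imsetP[z /[!inE] /andP[zZ zD] ->]; apply/cutq; exists z; split=> //.
  exact: subsetP zZ.
have mem z : z \in Z -> [disjoint z & D] ->
    z :\: C \in [set z :\: C | z in [set z in Z | [disjoint z & D]]].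
  by move=> zZ zD; apply/imsetP; exists z; rewrite // inE zZ.
move=> _ _ /cutq[a [ca aD ->]] /cutq[b [cb bD ->]].
case: (codim _ _ ca cb) => [aZ|bZ|abZ].
- by constructor 1; apply: mem.
- by constructor 2; apply: mem.
constructor 3; have := mem _ abZ; rewrite disjoints_subset => /(_ _).
have -> : symd a b :\: C = symd (a :\: C) (b :\: C).
  by apply/setP => t; rewrite !inE; case: (t \in C).
by apply; apply: symd_subset; rewrite -disjoints_subset.
Qed.

(** * Cut spaces as lists of words *)

Local Open Scope nat_scope.

Definition xorw (a b : seq bool) : seq bool := [seq q.1 (+) q.2 | q <- zip a b].
Definition dotw (a b : seq bool) : bool :=
  foldr addb false [seq q.1 && q.2 | q <- zip a b].
Definition weight (w : seq bool) : nat := count id w.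
Definition addw (w : seq bool) (c : seq nat) : seq nat :=
  [seq nat_of_bool q.1 + q.2 | q <- zip w c].
Definition clearw (i : nat) (w : seq bool) : seq bool := set_nth false w i false.

Fixpoint all_words (n : nat) : seq (seq bool) :=
  if n is n'.+1 then
    map (cons false) (all_words n') ++ map (cons true) (all_words n')
  else [:: [::]].

Definition span_words (n : nat) (cs : seq (seq bool)) : seq (seq bool) :=
  foldr (fun c acc => acc ++ map (xorw c) acc) [:: nseq n false] cs.

Lemma mem_all_words (w : seq bool) : w \in all_words (size w).
Proof.
elim: w => //= b w IHw; rewrite mem_cat; case: b; apply/orP; [right|left];
  exact: map_f.
Qed.

Lemma zip_map_map (S A B : Type) (f : S -> A) (g : S -> B) (s : seq S) :
  zip (map f s) (map g s) = [seq (f x, g x) | x <- s].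
Proof. by elim: s => //= x s ->. Qed.

Section Words.

Variables (T : finType) (els : seq T).
Hypotheses (els_uniq : uniq els) (els_full : forall t, t \in els).
Implicit Types (X Y : {set T}) (Z : {set {set T}}) (w : seq bool) (L : seq (seq bool)).
Local Notation n := (size els).

(** Characteristic words along a fixed enumeration turn questions on families of sets into list
    computations. *)
Definition word X : seq bool := [seq t \in X | t <- els].
Definition word_set w : {set T} := [set t | nth false w (index t els)].

Lemma size_word X : size (word X) = n.
Proof. exact: size_map. Qed.

Lemma nth_word X t : nth false (word X) (index t els) = (t \in X).
Proof. by rewrite (nth_map t) ?index_mem ?els_full // nth_index ?els_full. Qed.

Lemma wordK : cancel word word_set.
Proof. by move=> X; apply/setP => t; rewrite inE nth_word. Qed.

Lemma word_setK w : size w = n -> word (word_set w) = w.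
Proof.
move=> sw; apply: (@eq_from_nth _ false); rewrite size_word // => i lti.
have [t _] : exists t, t \in els by case: (els) lti => // t *; exists t; rewrite mem_head.
by rewrite (nth_map t) // inE index_uniq.
Qed.

Lemma word_eq w X : size w = n ->
  (forall t, nth false w (index t els) = (t \in X)) -> word X = w.
Proof.
move=> sw ew; rewrite -(word_setK sw); congr word; apply/setP => t.
by rewrite inE ew.
Qed.

Lemma word_symd X Y : word (symd X Y) = xorw (word X) (word Y).
Proof.
by rewrite /xorw zip_map_map -map_comp; apply: eq_map => t /=; rewrite in_symd.
Qed.

Lemma perm_els : perm_eq els (enum T).
Proof. by apply: uniq_perm; rewrite ?enum_uniq // => t; rewrite els_full mem_enum. Qed.

Lemma dotp_word X Y : dotp X Y = dotw (word X) (word Y).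
Proof.
rewrite /dotp -big_enum -(perm_big _ perm_els) /dotw zip_map_map -map_comp.
by elim: els => [|t s IHs]; rewrite ?big_nil // big_cons IHs.
Qed.

Lemma card_word X : #|X| = weight (word X).
Proof.
rewrite /weight count_map cardE -size_filter; apply/perm_size/uniq_perm.
- exact: enum_uniq.
- exact: filter_uniq.
by move=> t; rewrite mem_enum mem_filter els_full andbT.
Qed.

Lemma leq_card_words Z L : uniq L -> (forall w, w \in L -> size w = n) ->
  (forall w, w \in L -> word_set w \in Z) -> size L <= #|Z|.
Proof.
move=> uL sL LZ; rewrite cardE -(size_map word); apply: uniq_leq_size => // w wL.
by rewrite -(word_setK (sL _ wL)); apply: map_f; rewrite mem_enum LZ.
Qed.

(** * Certified even-cut spaces and single-element minors *)

Section Certificates.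

(* The two ends of every element, the parent vertex and the element joining it
   to its parent for every vertex but 0, and a vertex whose star is not in the
   even-cut space (if there is one). *)
Definition certificate : Type := (seq (nat * nat) * seq (nat * nat) * nat)%type.

Definition star_word (es : seq (nat * nat)) (v : nat) : seq bool :=
  [seq (q.1 == v) (+) (q.2 == v) | q <- es].
Definition cut_word (es : seq (nat * nat)) (c : seq bool) : seq bool :=
  [seq nth false c q.1 (+) nth false c q.2 | q <- es].
(** Recovers a vertex set from its cut: vertex 0 is left out, and entry [k] of the tree gives vertex
    [k.+1] the colour of its parent, flipped when the joining element is in the cut. *)
Definition tree_colour (tr : seq (nat * nat)) w : seq bool :=
  foldl (fun c q => rcons c (nth false c q.1 (+) nth false w q.2)) [:: false] tr.

(** The tree is a hint only, as each word of [L] is compared with the cut of the colouring rebuilt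
    from it. The last test bounds the codimension by one. *)
Definition certify (m : nat) L (c : certificate) : bool :=
  let: (es, tr, v0) := c in
  [&& size es == m, all (fun q => (q.1 <= size tr) && (q.2 <= size tr)) es,
      v0 <= size tr,
      all (fun w => cut_word es (tree_colour tr w) == w) L
    & all (fun v => (star_word es v \in L)
                 || (xorw (star_word es v) (star_word es v0) \in L))
          (iota 0 (size tr).+1)].

Lemma certifyP Z L c : binary_space Z -> (forall X, (X \in Z) = (word X \in L)) ->
  certify n L c -> even_cut_space Z.
Proof.
case: c => [[es tr] v0] [Z0 ZD] ZL /and5P[/eqP ses /allP bes bv0 /allP cutL /allP starL].
pose p t := let q := nth (0, 0) es (index t els) in
  (inord q.1 : 'I_(size tr).+1, inord q.2 : 'I_(size tr).+1).
have lt_es t : index t els < size es by rewrite ses index_mem.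
have pK t : (val (p t).1, val (p t).2) = nth (0, 0) es (index t els).
  have /andP[b1 b2] := bes _ (mem_nth (0, 0) (lt_es t)).
  by rewrite /= !inordK -?surjective_pairing.
have p1 t : val (p t).1 = (nth (0, 0) es (index t els)).1 by rewrite -pK.
have p2 t : val (p t).2 = (nth (0, 0) es (index t els)).2 by rewrite -pK.
have starE (x : 'I_(size tr).+1) : word (coboundary p [set x]) = star_word es x.
  apply: word_eq => [|t]; first by rewrite size_map.
  by rewrite (nth_map (0, 0)) // !inE -!val_eqE p1 p2.
exists 'I_(size tr).+1, p; split.
  apply/subsetP => X XZ; apply/cutsP; move: (XZ); rewrite ZL => /cutL/eqP.
  move: (tree_colour tr (word X)) => col eX.
  exists [set i : 'I_(size tr).+1 | nth false col i].
  apply/setP => t; rewrite -nth_word -eX (nth_map (0, 0)) //.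
  by rewrite !inE -p1 -p2.
pose d0 := coboundary p [set inord v0].
(* [Z] and its translate by [d0] are together closed under sums and contain the stars, hence all
   cuts; two cuts outside [Z] then have their sum in [Z]. *)
have cosets (w : {set T}) : w \in cuts p -> (w \in Z) || (symd w d0 \in Z).
  case/cutsP=> A ->; rewrite coboundaryE.
  apply: (big_ind (fun y : {set T} => (y \in Z) || (symd y d0 \in Z))).
  - by rewrite Z0.
  - move=> a b /orP[aZ|aZ] /orP[bZ|bZ].
    + by rewrite ZD.
    + by rewrite -symdA (ZD _ _ aZ bZ) orbT.
    + by rewrite (symdC a) -symdA (ZD _ _ bZ aZ) orbT.
    + have <- : symd (symd a d0) (symd b d0) = symd a b.
        by apply/setP => t; rewrite !in_symd addbACA addbb addbF.
      by rewrite ZD.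
  move=> x _; rewrite !ZL word_symd !starE inordK //.
  by apply: starL; rewrite mem_iota ltn_ord.
move=> a b /cosets/orP[aZ|aZ]; first by constructor 1.
move/cosets/orP=> [bZ|bZ]; first by constructor 2.
constructor 3; have <- : symd (symd a d0) (symd b d0) = symd a b.
  by apply/setP => t; rewrite !in_symd addbACA addbb addbF.
exact: ZD.
Qed.

(** The first certificate of a pair is for the deletion of the element, the second for its
    contraction. *)
Definition certify_minors (m : nat) L (cs : seq (certificate * certificate)) : bool :=
  all (fun i => let c := nth (([::], [::], 0), ([::], [::], 0)) cs i in
         certify m [seq w <- L | ~~ nth false w i] c.1
      && certify m [seq clearw i w | w <- L] c.2) (iota 0 m).

Lemma word_setD1 X i t0 : i < n -> word (X :\ nth t0 els i) = clearw i (word X).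
Proof.
move=> lti; apply: word_eq.
  by rewrite size_set_nth size_word; apply/maxn_idPr.
move=> t; rewrite nth_set_nth /= nth_word !inE.
have [<-|ni] := eqVneq (index t els) i; first by rewrite nth_index ?eqxx.
have [et|//] := eqVneq t (nth t0 els i).
by rewrite et index_uniq ?eqxx in ni.
Qed.

(** A proper minor removes some [e], so its cycle space is a minor of the space certified for the
    deletion or contraction of [e], and [even_cut_space_minor] applies. The same [C] and [D] serve
    for this second minor, because [e] no longer occurs in the certified space. *)
Lemma proper_minor_even_cut (M N : matroid T) Z L cs :
  ground M = setT -> cycle_space M Z -> (forall X, (X \in Z) = (word X \in L)) ->
  (forall w, w \in L -> size w = n) -> certify_minors n L cs ->
  proper_minor N M -> even_cut N.
Proof.
move=> gM cZ ZL sL /allP cert [C [D [_ CD /set0Pn[e eCD] ->]]].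
have [[Z0 ZD] _ _] := cZ.
apply: even_cut_of_space (minor_cycle_space C D cZ) _.
have lte : index e els < n by rewrite index_mem.
have ee : nth e els (index e els) = e by rewrite nth_index.
have ie : index e els \in iota 0 n by rewrite mem_iota.
have /andP[] := cert _ ie.
set c := nth _ _ _ => certD certC.
have [eD|eD] := boolP (e \in D).
  pose Ze := [set z in Z | e \notin z].
  have sZe : binary_space Ze.
    split=> [|a b]; first by rewrite !inE Z0.
    by rewrite !inE => /andP[aZ ea] /andP[bZ eb]; rewrite ZD // (negbTE ea) (negbTE eb).
  have ecs : even_cut_space Ze.
    apply: certifyP sZe _ certD => X; rewrite inE mem_filter -ZL nth_word.
    by rewrite andbC.
  suff -> : [set z in Z | [disjoint z & D]] = [set z in Ze | [disjoint z & D]].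
    exact: even_cut_space_minor.
  apply/setP => z; rewrite !inE; have [zD|] := boolP [disjoint z & D]; rewrite ?andbF //.
  by rewrite (contraL _ eD) ?andbT // => ez; rewrite (disjointFr zD).
have eC : e \in C by move: eCD; rewrite inE (negbTE eD) orbF.
pose Ze := [set z :\ e | z in Z].
have sZe : binary_space Ze.
  split; first by apply/imsetP; exists set0; rewrite ?set0D.
  move=> _ _ /imsetP[a aZ ->] /imsetP[b bZ ->]; apply/imsetP; exists (symd a b).
    exact: ZD.
  by apply/setP => x; rewrite !inE; case: (x == e).
have ecs : even_cut_space Ze.
  apply: certifyP sZe _ certC => X; apply/imsetP/mapP => [[z zZ ->]|[w wL eX]].
    by exists (word z); rewrite -?ZL // -{1}ee word_setD1.
  exists (word_set w); first by rewrite ZL word_setK ?sL.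
  by apply: (can_inj wordK); rewrite eX -{2}ee word_setD1 // word_setK ?sL.
have := even_cut_space_minor C D ecs; set Y := imset _ _; set Y' := imset _ _.
suff -> : Y = Y' by [].
have eq_disj z : [disjoint z :\ e & D] = [disjoint z & D].
  rewrite !disjoints_subset; apply/subsetP/subsetP => sz x; last first.
    by rewrite inE => /andP[_ /sz].
  move=> xz; have [->|xe] := eqVneq x e; first by rewrite inE.
  by apply: sz; rewrite !inE xe.
have eq_diff z : z :\ e :\: C = z :\: C.
  by apply/setP => x; rewrite !inE; have [->|//] := eqVneq x e; rewrite eC.
apply/setP => w; apply/imsetP/imsetP => -[z]; rewrite inE => /andP[zZ zD ->].
  case/imsetP: zZ zD => y yZ -> yD; exists y; rewrite ?eq_diff // inE yZ.
  by rewrite -eq_disj.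
exists (z :\ e); rewrite ?eq_diff // inE eq_disj zD andbT.
by apply/imsetP; exists z.
Qed.

End Certificates.

End Words.

(** * Vertex stars: double counting and a lower bound on their number *)

Section Stars.

Variables (T V : finType) (p : T -> V * V).
Implicit Types (A : {set V}) (v : V) (t : T).

Definition star v : {set T} := coboundary p [set v].
(** Vertices that are isolated or carry only loops can be added at will without changing the cuts,
    so they are left out of every count. *)
Definition nonisolated : {set V} := [set v | star v != set0].

Lemma in_star t v : (t \in star v) = ((p t).1 == v) (+) ((p t).2 == v).
Proof. by rewrite !inE. Qed.

Lemma star_cuts v : star v \in cuts p.
Proof. by apply/cutsP; exists [set v]. Qed.

(** Only the two ends of [t] can have [t] in their star; a loop lies in none. *)
Lemma count_star t (s : seq V) : uniq s -> count (fun v => t \in star v) s <= 2.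
Proof.
move=> us; rewrite -size_filter -[2]/(size [:: (p t).1; (p t).2]).
apply: uniq_leq_size; first exact: filter_uniq.
move=> v; rewrite mem_filter in_star !inE ![v == _]eq_sym.
by case: eqP => //; case: eqP.
Qed.

Lemma nonisolatedP t : (p t).1 != (p t).2 ->
  ((p t).1 \in nonisolated) && ((p t).2 \in nonisolated).
Proof.
move=> ne; rewrite !inE; apply/andP; split; apply/set0Pn; exists t.
  by rewrite in_star eqxx eq_sym (negbTE ne).
by rewrite in_star eqxx (negbTE ne).
Qed.

Lemma coboundaryI A : coboundary p (A :&: nonisolated) = coboundary p A.
Proof.
apply/setP => t; rewrite !in_set.
have [->|/nonisolatedP] := eqVneq (p t).1 (p t).2; first by rewrite !addbb.
by rewrite !in_set => /andP[-> ->]; rewrite !andbT.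
Qed.

Lemma coboundaryC A : coboundary p (~: A) = coboundary p A.
Proof. by apply/setP => t; rewrite !inE addbN addNb negbK. Qed.

Lemma sum_card_star (S : {set T}) : (forall v, star v \subset S) ->
  \sum_(v in nonisolated) #|star v| <= 2 * #|S|.
Proof.
move=> sS; apply: leq_trans (_ : \sum_(v : V) \sum_(t in S) (t \in star v) <= _).
  rewrite [leqRHS](bigID (mem nonisolated)) /=; apply: leq_trans (leq_addr _ _).
  apply: leq_sum => v _; rewrite -sum1_card [leqLHS]big_mkcond [leqRHS]big_mkcond /=.
  apply: leq_sum => t _; case: (boolP (t \in star v)) => // tv.
  by rewrite (subsetP (sS v)).
rewrite exchange_big /= mulnC -sum_nat_const; apply: leq_sum => t _.
apply: leq_trans (count_star t (index_enum_uniq V)).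
by rewrite -sum1_count [leqRHS]big_mkcond.
Qed.

(* Complementing a vertex set does not change its cut, so one non-isolated
   vertex may be kept out of it. *)
Lemma leq_nonisolated k : 2 ^ k < #|cuts p| -> k.+2 <= #|nonisolated|.
Proof.
move=> ltk; have [N0|/set0Pn[v0 v0N]] := eqVneq nonisolated set0.
  have /subset_leq_card : cuts p \subset [set set0].
    apply/subsetP => _ /cutsP[A ->]; rewrite inE -coboundaryI N0 setI0.
    by apply/eqP/setP => t; rewrite !inE.
  by rewrite cards1 => /(leq_trans ltk); rewrite ltnS leqn0 expn_eq0.
have sub : cuts p \subset [set coboundary p A | A in powerset (nonisolated :\ v0)].
  apply/subsetP => _ /cutsP[A ->]; pose B := if v0 \in A then ~: A else A.
  have -> : coboundary p A = coboundary p (B :&: nonisolated).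
    by rewrite coboundaryI /B; case: ifP => // _; rewrite coboundaryC.
  apply: imset_f; rewrite inE subsetD1 subsetIr inE negb_and.
  by rewrite /B; case: (boolP (v0 \in A)) => [vA|->] //; rewrite inE vA.
have := leq_trans ltk (leq_trans (subset_leq_card sub) (leq_imset_card _ _)).
by rewrite card_powerset ltn_exp2l // (cardsD1 v0 nonisolated) v0N.
Qed.

(** At least [k.+2] stars are nonempty by [leq_nonisolated], each is a cut of at least three
    elements, and together they cover [S] at most twice. *)
Lemma cuts_girth3 k (S : {set T}) : 2 ^ k < #|cuts p| ->
  (forall w, w \in cuts p -> w \subset S) ->
  (forall w, w \in cuts p -> w != set0 -> 3 <= #|w|) -> 3 * k.+2 <= 2 * #|S|.
Proof.
move=> /leq_nonisolated ltk sS g3.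
apply: leq_trans (sum_card_star (fun v => sS _ (star_cuts v))).
rewrite mulnC; apply: leq_trans (leq_mul ltk (leqnn 3)) _.
rewrite -sum_nat_const; apply: leq_sum => v; rewrite inE => nv.
exact: g3 (star_cuts v) nv.
Qed.

End Stars.

(* Decides whether at least need words of l, each used at most twice, of total
   weight at most R, can be added to cs so that every position is covered at most
   twice (cov counts the coverage by cs) and the words of L are spanned. As l is
   sorted by weight, need * weight w bounds the weight still to come. *)
Fixpoint star_search (L : seq (seq bool)) (m need R : nat) (cov : seq nat)
    (cs l : seq (seq bool)) : bool :=
  if l is w :: l' then
    if need * weight w <= R then
      if star_search L m need R cov cs l' then true else
      let cov1 := addw w cov in
      if all (leq^~ 2) cov1 then
        if star_search L m need.-1 (R - weight w) cov1 (w :: cs) l' then true else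
        let cov2 := addw w cov1 in
        if all (leq^~ 2) cov2 then
          star_search L m need.-2 (R - weight w - weight w) cov2 [:: w, w & cs] l'
        else false
      else false
    else false
  else
    if need == 0 then let S := span_words m cs in all (fun w => w \in S) L else false.

(** * Completeness of the star search *)

Section StarSearch.

Variables (T : finType) (els : seq T).
Hypotheses (els_uniq : uniq els) (els_full : forall t, t \in els).
Variables (V : finType) (p : T -> V * V) (L : seq (seq bool)) (K : nat).
Implicit Types (A : {set V}) (vs : seq V).
Local Notation n := (size els).
Local Notation sw v := (word els (star p v)).
Local Notation NI := (nonisolated p).
Hypothesis leK : K <= #|NI|.
Hypothesis L_cuts : forall w, w \in L -> exists A, w = word els (coboundary p A).

Definition coverage (vs : seq V) : seq nat :=
  [seq count (fun v => t \in star p v) vs | t <- els].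

Lemma coverage_cons v vs : coverage (v :: vs) = addw (sw v) (coverage vs).
Proof. by rewrite /addw /word /coverage zip_map_map -map_comp. Qed.

Lemma all_coverage vs : uniq vs -> all (leq^~ 2) (coverage vs).
Proof. by move=> us; apply/allP => _ /mapP[t _ ->]; apply: count_star. Qed.

Lemma span_words_star A vs :
  \big[xorw/nseq n false]_(v <- vs | v \in A) sw v \in span_words n [seq sw v | v <- vs].
Proof.
elim: vs => [|v vs IHvs] /=; first by rewrite big_nil mem_head.
rewrite big_cons mem_cat; case: ifP => _; last by rewrite IHvs.
by rewrite map_f ?orbT.
Qed.

Lemma word_coboundary A vs : uniq vs -> vs =i NI ->
  word els (coboundary p A) = \big[xorw/nseq n false]_(v <- vs | v \in A) sw v.
Proof.
move=> us eN; rewrite -coboundaryI coboundaryE.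
have -> : \big[@symd T/set0]_(x in A :&: NI) coboundary p [set x] =
    \big[@symd T/set0]_(x <- vs | x \in A) star p x.
  rewrite -big_enum -[RHS]big_filter; apply: perm_big; apply: uniq_perm.
  - exact: enum_uniq.
  - exact: filter_uniq.
  by move=> v; rewrite mem_enum mem_filter inE eN.
apply: (big_morph (word els)) => [X Y|]; first exact: word_symd.
by apply: (@eq_from_nth _ false); rewrite ?size_map ?size_nseq // => i lti;
  rewrite nth_nseq lti; case: (els) i lti => // t0 s i lti; rewrite (nth_map t0) ?inE.
Qed.

(** [vs] holds the vertices whose stars have been chosen; the remaining stars occur in [l]. On the
    path that adds [w] once for every remaining vertex with star [w], all tests succeed. *)
Lemma star_search_complete l vs : uniq vs -> {subset vs <= NI} ->
  (forall v, v \in NI -> v \notin vs -> sw v \in l) ->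
  sorted (fun a b => weight a <= weight b) l ->
  star_search L n (K - size vs) (2 * n - \sum_(v <- vs) weight (sw v))
    (coverage vs) [seq sw v | v <- vs] l.
Proof.
elim: l vs => [|w l IHl] vs uvs vsN restP sl /=.
  have eN : vs =i NI.
    by move=> v; apply/idP/idP => [/vsN//|vN]; apply: contraT => /(restP _ vN).
  (* All nonisolated vertices have been chosen, hence at least [K], and their stars span the words
     of [L]. *)
  have -> : (K - size vs == 0) = true.
    by rewrite subn_eq0 (leq_trans leK) // -(card_uniqP uvs) (eq_card eN).
  apply/allP => w /L_cuts[A ->]; rewrite (word_coboundary A uvs eN).
  exact: span_words_star.
pose rest := [seq v <- enum NI | v \notin vs].
have perm_rest : perm_eq (vs ++ rest) (enum NI).
  apply: uniq_perm => [||v]; rewrite ?enum_uniq //.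
    rewrite cat_uniq uvs filter_uniq ?enum_uniq // andbT /=.
    by apply/hasPn => v; rewrite mem_filter => /andP[].
  rewrite mem_cat mem_filter mem_enum; case: (boolP (v \in vs)) => [/vsN ->|] //.
have size_rest : K - size vs <= size rest.
  by rewrite leq_subLR -size_cat (perm_size perm_rest) -cardE.
have sum_rest : \sum_(v <- rest) weight (sw v) <= 2 * n - \sum_(v <- vs) weight (sw v).
  rewrite -(addKn (\sum_(v <- vs) weight (sw v)) (\sum_(v <- rest) _)).
  apply: leq_sub2r; rewrite -big_cat (perm_big _ perm_rest) big_enum /=.
  rewrite (perm_size (perm_els els_uniq els_full)) -cardE -cardsT.
  apply: leq_trans (sum_card_star (fun v => subsetT (star p v))).
  by apply: leq_sum => v _; rewrite (card_word els_uniq els_full).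
(* The pruning test passes: at least [K - size vs] stars remain, none lighter than [w] as the list
   is sorted, and their total weight fits in the budget. *)
have -> : (K - size vs) * weight w <= 2 * n - \sum_(v <- vs) weight (sw v).
  apply: leq_trans sum_rest; apply: leq_trans (leq_mul size_rest (leqnn _)) _.
  rewrite -sum1_size big_distrl /= big_seq [leqRHS]big_seq; apply: leq_sum => v.
  rewrite mem_filter mem_enum mul1n => /andP[vvs vN].
  have := restP _ vN vvs; rewrite inE => /predU1P[->//|vl].
  have /(order_path_min _) /allP/(_ _ vl) := sl; apply.
  by move=> a b c; apply: leq_trans.
have sl' := path_sorted sl.
pose U := [seq v <- rest | sw v == w].
have UN v : v \in U -> [/\ v \in NI, v \notin vs & sw v = w].
  by rewrite mem_filter mem_filter mem_enum => /and3P[/eqP].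
have uU0 : uniq U by do 2!apply: filter_uniq; apply: enum_uniq.
have uU : uniq (U ++ vs).
  rewrite cat_uniq uvs uU0 andbT /=.
  by apply/hasPn => v vvs; apply/negP => /UN[_]; rewrite vvs.
(* An element of the nonempty word [w] lies in the star of every vertex of [U], so [count_star]
   bounds [U] by two, the most copies that the search tries. *)
have sU : size U <= 2.
  case eU: U => [//|u U']; rewrite -eU.
  have [] := UN u; first by rewrite eU mem_head.
  rewrite inE => /set0Pn[t tu] _ eu.
  rewrite (leq_trans _ (@count_star _ _ p t U _)) //.
  rewrite -size_filter (_ : [seq v <- U | t \in star p v] = U) //.
  apply/all_filterP/allP => v /UN[_ _ ev].
  by rewrite -(can_inj (wordK els_full) (etrans eu (esym ev))).
have := IHl (U ++ vs) uU; move: UN sU uU.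
have {}restP v : v \in NI -> v \notin U ++ vs -> sw v \in l.
  move=> vN; rewrite mem_cat negb_or => /andP[vU vvs].
  have := restP _ vN vvs; rewrite inE => /predU1P[ev|//].
  by rewrite mem_filter mem_filter mem_enum vN vvs ev eqxx in vU.
move: restP {uU0}; case: U => [|a [|b [|? ?]]] //= restP UN _ uU IH.
- by rewrite IH.
- have [aN _ ea] := UN a (mem_head _ _).
  have cov1 : all (leq^~ 2) (addw w (coverage vs)).
    by rewrite -ea -coverage_cons; apply: all_coverage.
  have sub : {subset a :: vs <= NI} by move=> v; rewrite inE => /predU1P[->//|/vsN].
  have := IH sub restP sl'; rewrite big_cons addnC subnDA subnS coverage_cons ea => IH1.
  by case: ifP => // _; rewrite cov1 IH1.
have [aN _ ea] := UN a (mem_head _ _).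
have [|bN _ eb] := UN b; first by rewrite !inE eqxx orbT.
have cov1 : all (leq^~ 2) (addw w (coverage vs)).
  by rewrite -eb -coverage_cons; apply: all_coverage; case/andP: uU.
have cov2 : all (leq^~ 2) (addw w (addw w (coverage vs))).
  by rewrite -{2}eb -ea -!coverage_cons; apply: all_coverage.
have sub : {subset [:: a, b & vs] <= NI}.
  by move=> v; rewrite !in_cons => /or3P[/eqP ->|/eqP ->|/vsN].
have := IH sub restP sl'; rewrite !big_cons !coverage_cons ea eb.
rewrite [weight w + _]addnC (addnC (weight w)) !subnDA !subnS => IH2.
by case: ifP => // _; rewrite cov1; case: ifP => // _; rewrite cov2 IH2.
Qed.

End StarSearch.

Lemma dotw_xorw (y a b : seq bool) : size a = size b ->
  dotw y (xorw a b) = dotw y a (+) dotw y b.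
Proof.
rewrite /dotw /xorw; elim: a y b => [|x a IHa] [|c y] [|d b] //= [sab].
by rewrite IHa // addbACA andb_addr.
Qed.

Lemma span_wordsP n (cs : seq (seq bool)) (w : seq bool) :
  (forall c, c \in cs -> size c = n) -> w \in span_words n cs ->
  size w = n /\ forall y, (forall c, c \in cs -> dotw y c = false) -> dotw y w = false.
Proof.
elim: cs w => [|c cs IHcs] w scs /=.
  rewrite inE => /eqP ->; rewrite size_nseq; split=> // y _.
  by elim: n y {scs} => [|n IHn] [|b y] //=; rewrite /dotw /= andbF; apply: IHn.
have scs' d : d \in cs -> size d = n by move=> dcs; apply: scs; rewrite inE dcs orbT.
have sc : size c = n by apply: scs; rewrite mem_head.
rewrite mem_cat => /orP[/(IHcs _ scs')[sw dw]|/mapP[d /(IHcs _ scs')[sd dd] ->]].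
  by split=> // y dy; apply: dw => d dcs; apply: dy; rewrite inE dcs orbT.
split=> [|y dy]; first by rewrite size_map size_zip sc sd minnn.
rewrite dotw_xorw ?sc // dy ?mem_head // dd // => e ecs.
by apply: dy; rewrite inE ecs orbT.
Qed.

Lemma nth_map_dflt (A B : Type) (f : A -> B) x0 s i :
  nth (f x0) (map f s) i = f (nth x0 s i).
Proof. by elim: s i => [|x s IHs] [|i] //=. Qed.

Lemma size_all_words n w : w \in all_words n -> size w = n.
Proof.
elim: n w => [|n IHn] w /=; first by rewrite inE => /eqP ->.
by rewrite mem_cat => /orP[] /mapP[u /IHn su ->] /=; rewrite su.
Qed.

(** * The matroid H12* *)

Local Notation els12 := (enum 'I_12).

Lemma els12_uniq : uniq els12. Proof. exact: enum_uniq. Qed.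

Lemma els12_full (t : 'I_12) : t \in els12. Proof. exact: mem_enum. Qed.

Lemma size_els12 : size els12 = 12. Proof. exact: size_enum_ord. Qed.

Definition H12_row_words : seq (seq bool) := map (map odd) H12_rows.

Definition H12_words : seq (seq bool) := span_words 12 H12_row_words.

Lemma word_H12_row (i : 'I_5) :
  word els12 [set j | H12_mx i j != 0%R] = nth [::] H12_row_words i.
Proof.
apply: word_eq => //; first exact: els12_uniq.
  by rewrite size_els12; case: i => -[|[|[|[|[|//]]]]] ?.
move=> t; rewrite index_enum_ord inE mxE natrF2_odd.
by rewrite -[false]/(odd 0) -[[::]]/(map odd [::]) !nth_map_dflt.
Qed.

Lemma H12_row_words_size c : c \in H12_row_words -> size c = 12.
Proof.
have /allP h : all (fun c => size c == 12) H12_row_words by [].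
by move/h/eqP.
Qed.

Lemma H12_words_size w : w \in H12_words -> size w = 12.
Proof. by case/(span_wordsP H12_row_words_size). Qed.

Lemma H12_row_words_sub : {subset H12_row_words <= H12_words}.
Proof. by apply/allP; vm_compute. Qed.

Definition H12_dual_space : {set {set 'I_12}} :=
  [set X | word els12 X \in H12_words].

Lemma in_H12_dual X : (X \in H12_dual_space) = (word els12 X \in H12_words).
Proof. by rewrite in_set. Qed.

Lemma H12_words_xorw :
  {in H12_words &, forall a b, xorw a b \in H12_words}.
Proof.
have /allP h : all (fun a => all (fun b => xorw a b \in H12_words) H12_words) H12_words.
  by vm_compute.
by move=> a b aH bH; have /allP := h _ aH; apply.
Qed.

Lemma H12_dual_binary : binary_space H12_dual_space.
Proof.
split=> [|a b]; rewrite !in_H12_dual.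
  suff -> : word els12 set0 = nseq 12 false by [].
  by apply: word_eq => [//||t]; rewrite ?els12_uniq ?size_els12 // inE nth_nseq if_same.
move=> aH bH; rewrite word_symd.
exact: H12_words_xorw.
Qed.

(** The cycle space of [H12] is orthogonal to the rows of [H12_mx], so that of the dual is the
    double complement, which is the row space: by [span_wordsP] the rows and their span have the
    same complement. *)
Lemma H12_dual_cycle_space : cycle_space (dual H12) H12_dual_space.
Proof.
suff eY : perp setT (row_supports H12_mx) = perp setT H12_dual_space.
  have := dual_cycle_space (vector_matroid_cycle_space H12_mx).
  rewrite eY perpK //; first exact: H12_dual_binary.
  by move=> z _; apply: subsetT.
apply/setP => y; apply/perpP/perpP => -[_ py]; split=> [|z zP]; try exact: subsetT.
- move: zP; rewrite in_H12_dual (dotp_word els12_uniq els12_full) => zP.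
  have [_] := span_wordsP H12_row_words_size zP.
  apply=> c /(nthP [::])[i lti <-].
  rewrite -(word_H12_row (Ordinal (lti : i < 5))) -(dotp_word els12_uniq els12_full).
  by apply: py; apply/imsetP; eexists.
case/imsetP: zP => i _ ->; apply: py; rewrite in_H12_dual word_H12_row.
by apply/H12_row_words_sub/mem_nth; case: i.
Qed.

(* Found by computer search. *)
Definition H12_dual_certs : seq (certificate * certificate) :=
  [:: (([:: (0,0); (0,1); (1,2); (0,2); (1,3); (0,3); (0,4); (1,4); (0,5); (1,5); (0,2); (1,2)],
    [:: (0,1); (0,3); (0,5); (0,6); (0,8)], 2),
   ([:: (0,0); (0,1); (1,2); (1,3); (2,4); (3,4); (2,5); (3,5); (2,6); (3,6); (0,2); (0,3)],
    [:: (0,1); (0,10); (0,11); (2,4); (2,6); (2,8)], 1));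
   (([:: (0,1); (0,0); (0,2); (1,2); (0,3); (1,3); (0,4); (1,4); (0,5); (1,5); (0,2); (1,2)],
    [:: (0,0); (0,2); (0,4); (0,6); (0,8)], 2),
   ([:: (0,1); (0,0); (1,3); (1,2); (3,4); (2,4); (3,5); (2,5); (3,6); (2,6); (0,2); (0,3)],
    [:: (0,0); (0,10); (0,11); (2,5); (2,7); (2,9)], 1));
   (([:: (0,1); (1,2); (0,0); (0,2); (0,3); (4,5); (2,4); (0,4); (0,5); (2,5); (1,2); (0,1)],
    [:: (0,0); (0,3); (0,4); (0,7); (0,8)], 2),
   ([:: (0,1); (1,6); (0,0); (1,5); (0,2); (6,2); (0,3); (6,3); (0,4); (6,4); (0,5); (6,5)],
    [:: (0,0); (0,4); (0,6); (0,8); (0,10); (1,1)], 1));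
   (([:: (0,1); (1,2); (0,2); (0,0); (0,3); (4,5); (0,4); (2,4); (0,5); (2,5); (0,1); (1,2)],
    [:: (0,0); (0,2); (0,4); (0,6); (0,8)], 2),
   ([:: (0,1); (1,6); (1,5); (0,0); (6,2); (0,2); (0,3); (6,3); (0,4); (6,4); (6,5); (0,5)],
    [:: (0,0); (0,5); (0,6); (0,8); (0,11); (1,1)], 1));
   (([:: (0,1); (0,2); (0,3); (4,5); (0,0); (1,2); (2,4); (1,4); (1,5); (2,5); (2,3); (1,3)],
    [:: (0,0); (0,1); (0,2); (1,7); (1,8)], 0),
   ([:: (0,1); (0,2); (0,3); (6,4); (0,0); (6,5); (1,4); (2,4); (1,5); (2,5); (2,3); (1,3)],
    [:: (0,0); (0,1); (0,2); (1,6); (1,8); (4,3)], 0));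
   (([:: (0,1); (0,2); (0,3); (4,5); (1,2); (0,0); (1,4); (2,4); (1,5); (2,5); (2,3); (1,3)],
    [:: (0,0); (0,1); (0,2); (1,6); (1,8)], 0),
   ([:: (0,1); (0,2); (0,3); (6,4); (6,5); (0,0); (2,4); (1,4); (1,5); (2,5); (2,3); (1,3)],
    [:: (0,0); (0,1); (0,2); (1,7); (1,8); (4,3)], 0));
   (([:: (0,1); (0,2); (0,3); (4,5); (2,4); (1,4); (0,0); (1,2); (1,5); (2,5); (2,3); (1,3)],
    [:: (0,0); (0,1); (0,2); (1,5); (1,8)], 0),
   ([:: (0,1); (0,2); (0,3); (4,6); (1,4); (2,4); (0,0); (6,5); (1,5); (2,5); (2,3); (1,3)],
    [:: (0,0); (0,1); (0,2); (1,4); (1,8); (4,3)], 0));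
   (([:: (0,1); (0,2); (0,3); (4,5); (1,4); (2,4); (1,2); (0,0); (1,5); (2,5); (2,3); (1,3)],
    [:: (0,0); (0,1); (0,2); (1,4); (1,8)], 0),
   ([:: (0,1); (0,2); (0,3); (4,6); (2,4); (1,4); (6,5); (0,0); (1,5); (2,5); (2,3); (1,3)],
    [:: (0,0); (0,1); (0,2); (1,5); (1,8); (4,3)], 0));
   (([:: (0,1); (0,2); (0,3); (4,5); (2,4); (1,4); (1,5); (2,5); (0,0); (1,2); (2,3); (1,3)],
    [:: (0,0); (0,1); (0,2); (1,5); (1,6)], 0),
   ([:: (0,1); (0,2); (0,3); (4,6); (1,4); (2,4); (1,5); (2,5); (0,0); (6,5); (2,3); (1,3)],
    [:: (0,0); (0,1); (0,2); (1,4); (1,6); (4,3)], 0));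
   (([:: (0,1); (0,2); (0,3); (4,5); (1,4); (2,4); (1,5); (2,5); (1,2); (0,0); (2,3); (1,3)],
    [:: (0,0); (0,1); (0,2); (1,4); (1,6)], 0),
   ([:: (0,1); (0,2); (0,3); (4,6); (2,4); (1,4); (1,5); (2,5); (6,5); (0,0); (2,3); (1,3)],
    [:: (0,0); (0,1); (0,2); (1,5); (1,6); (4,3)], 0));
   (([:: (0,1); (1,5); (1,5); (0,1); (5,2); (0,2); (0,3); (5,3); (0,4); (5,4); (0,0); (0,5)],
    [:: (0,0); (0,5); (0,6); (0,8); (0,11)], 1),
   ([:: (0,1); (1,6); (0,2); (6,2); (0,3); (6,3); (0,4); (6,4); (0,5); (6,5); (0,0); (1,2)],
    [:: (0,0); (0,2); (0,4); (0,6); (0,8); (1,1)], 2));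
   (([:: (0,1); (1,5); (0,1); (1,5); (0,2); (5,2); (0,3); (5,3); (0,4); (5,4); (0,5); (0,0)],
    [:: (0,0); (0,4); (0,6); (0,8); (0,10)], 1),
   ([:: (0,1); (1,6); (6,2); (0,2); (6,3); (0,3); (0,4); (6,4); (0,5); (6,5); (1,2); (0,0)],
    [:: (0,0); (0,3); (0,5); (0,6); (0,8); (1,1)], 2)) ]%N.

Lemma H12_dual_certified : certify_minors 12 H12_words H12_dual_certs.
Proof. by vm_compute. Qed.

Lemma H12_dual_proper_minor N : proper_minor N (dual H12) -> even_cut N.
Proof.
apply: (@proper_minor_even_cut _ els12 els12_uniq els12_full (dual H12) N
  H12_dual_space H12_words H12_dual_certs _ H12_dual_cycle_space in_H12_dual) => //;
  rewrite size_els12; [exact: H12_words_size | exact: H12_dual_certified].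
Qed.

(** Stars of nonisolated vertices are nonempty, so the zero word is dropped. The budget [2 * m]
    allows each of the [m] elements to be covered twice. *)
Definition refute_stars (m K : nat) (G L : seq (seq bool)) : bool :=
  ~~ star_search G m K (2 * m) (nseq m 0) [::]
       (sort (fun a b => weight a <= weight b) (filter (has id) L)).

(** When the words of [L] are the cuts of a graph, the search started with no star chosen finds its
    stars, of which at least [k.+2] are nonempty by [leq_nonisolated]. *)
Lemma refute_starsP (T V : finType) (els : seq T) (p : T -> V * V) k G L :
  uniq els -> (forall t, t \in els) -> 2 ^ k < #|cuts p| ->
  (forall X, (X \in cuts p) = (word els X \in L)) ->
  (forall w, w \in L -> size w = size els) -> {subset G <= L} ->
  ~~ refute_stars (size els) k.+2 G L.
Proof.
move=> uels fels /leq_nonisolated leK cL sL GL; rewrite negbK.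
have sT : total (fun a b => weight a <= weight b) by move=> a b; apply: leq_total.
have := @star_search_complete _ els uels fels _ p G k.+2 leK _ _ [::] isT _ _ (sort_sorted sT _).
rewrite big_nil !subn0 /coverage /=.
have -> : [seq 0 | _ <- els] = nseq (size els) 0 by elim: (els) => //= t s ->.
apply=> // [w /GL wL|v vN _].
  have /cutsP[A eA] : word_set els w \in cuts p by rewrite cL word_setK ?sL.
  by exists A; rewrite -eA word_setK ?sL.
rewrite mem_sort mem_filter -cL star_cuts andbT.
move: vN; rewrite inE => /set0Pn[t tv]; apply/hasP; exists true => //.
by apply/mapP; exists t.
Qed.

(* The columns 0, 1, 2, 4 and 8 of H12_mx form a basis, so every coset of its row
   space has a member vanishing there. *)
Definition H12_pivot_free (w : seq bool) : bool :=
  all (fun i => ~~ nth false w i) [:: 0; 1; 2; 4; 8].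

Lemma H12_pivots x : size x = 12 ->
  exists2 z, z \in H12_words & H12_pivot_free (xorw x z).
Proof.
have h : all (fun x => has (fun z => H12_pivot_free (xorw x z)) H12_words) (all_words 12).
  by vm_compute.
by move=> sx; apply/hasP; apply: (allP h); rewrite -sx mem_all_words.
Qed.

(** The row space has 32 members, more than [2 ^ 4], so a graph with exactly these cuts has at least
    six nonempty stars. *)
Lemma H12_refuted : refute_stars 12 6 H12_row_words H12_words.
Proof. by vm_compute. Qed.

(** Seven positions are free once the pivots vanish, which gives 128 words [x]. A space properly
    containing the row space has more than [2 ^ 5] members, hence at least seven nonempty stars. *)
Lemma H12_extensions_refuted :
  all (fun x => refute_stars 12 7 (x :: H12_row_words)
                  (H12_words ++ map (xorw x) H12_words))
    [seq x <- all_words 12 | H12_pivot_free x].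
Proof. by vm_compute. Qed.

Lemma card_H12_dual : 32 <= #|H12_dual_space|.
Proof.
have uH : uniq H12_words by vm_compute.
have := @leq_card_words _ _ els12_uniq H12_dual_space _ uH.
rewrite size_els12 [size H12_words](_ : _ = 32); last by vm_compute.
apply=> // w wH; first exact: H12_words_size.
by rewrite in_H12_dual word_setK ?els12_uniq // size_els12 H12_words_size.
Qed.

Lemma H12_dual_not_even_cut : ~ even_cut (dual H12).
Proof.
have gH : ground (dual H12) = setT by [].
case/(even_cut_matroid_space gH H12_dual_cycle_space) => V [p [ZW codim]].
have [_ ZD] := H12_dual_binary; have [_ WD] := cuts_space p.
have [eW|/subsetPn[x xW xZ]] := boolP (cuts p \subset H12_dual_space).
  have {}eW : cuts p = H12_dual_space by apply/eqP; rewrite eqEsubset eW.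
  have := @refute_starsP _ _ _ p 4 H12_row_words H12_words els12_uniq els12_full.
  rewrite eW size_els12 H12_refuted => h.
  have c4 : 2 ^ 4 < #|H12_dual_space| by apply: leq_trans card_H12_dual.
  by have := h c4 in_H12_dual H12_words_size H12_row_words_sub.
(* Translating [x] by a member of the row space makes it vanish on the pivots without leaving its
   coset, so the cut space becomes one of those already refuted. *)
have [z zH pz] := H12_pivots (etrans (size_word _ x) size_els12).
have ez : word els12 (word_set els12 z) = z.
  by rewrite word_setK ?els12_uniq // size_els12 H12_words_size.
pose y := symd x (word_set els12 z).
have zZ : word_set els12 z \in H12_dual_space by rewrite in_H12_dual ez.
have yW : y \in cuts p by apply: WD => //; apply: (subsetP ZW).
have yZ : y \notin H12_dual_space.
  by apply: contra xZ => yZ; rewrite -(symdK x (word_set els12 z)) ZD.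
have ey : word els12 y = xorw (word els12 x) z by rewrite word_symd ez.
have sy : size (word els12 y) = 12 by rewrite size_word size_els12.
pose L := H12_words ++ map (xorw (word els12 y)) H12_words.
have := allP H12_extensions_refuted (word els12 y).
have aw : word els12 y \in all_words 12 by have := mem_all_words (word els12 y); rewrite sy.
rewrite mem_filter aw andbT {1}ey => /(_ pz); rewrite -/L => refL.
have := @refute_starsP _ _ _ p 5 (word els12 y :: H12_row_words) L els12_uniq els12_full.
rewrite size_els12 refL => h; suff: ~~ true by [].
(* By the codimension condition the cuts are the row space together with its translate by [y]. *)
have cL X : (X \in cuts p) = (word els12 X \in L).
  rewrite mem_cat -in_H12_dual; apply/idP/orP => [XW|[/(subsetP ZW)//|]].
    have [|//|XyZ] := codim _ _ XW yW; first by left.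
      by rewrite (negbTE yZ).
    right; apply/mapP; exists (word els12 (symd X y)); first by rewrite -in_H12_dual.
    by rewrite -word_symd symdC symdK.
  case/mapP=> u uH; have eu : word els12 (word_set els12 u) = u.
    by rewrite word_setK ?els12_uniq // size_els12 H12_words_size.
  rewrite -{1}eu -word_symd => /(can_inj (wordK els12_full)) ->.
  by apply: WD => //; rewrite (subsetP ZW) // in_H12_dual eu.
apply: h (cL) _ _.
- apply: leq_ltn_trans card_H12_dual _; apply: proper_card; apply/properP; split=> //.
  by exists y.
- move=> w; rewrite mem_cat => /orP[/H12_words_size//|/mapP[u uH ->]].
  by rewrite size_map size_zip sy H12_words_size.
move=> w; rewrite inE => /predU1P[->|/H12_row_words_sub wH]; first by rewrite -cL.
by rewrite mem_cat wH.
Qed.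

(** * The matroid M(K6) *)

Local Notation K6 := (complete_graph 6).

Definition K6_pairs : seq (nat * nat) :=
  [seq (i, j) | i <- iota 0 6, j <- iota i.+1 (5 - i)].

Definition K6_pair (t : edge K6) : nat * nat :=
  (nat_of_ord (ends t).1, nat_of_ord (ends t).2).

(** An edge carries a proof that its ends are increasing, whence [insub]; [map_els15] shows that no
    pair is dropped. *)
Definition els15 : seq (edge K6) :=
  pmap (fun q => insub (inord q.1, inord q.2) : option (edge K6)) K6_pairs.

Lemma K6_pair_inj : injective K6_pair.
Proof.
move=> [[i j] ?] [[k l] ?] [/= ik jl]; apply/val_inj => /=.
by congr (_, _); apply/val_inj.
Qed.

Lemma map_els15 : map K6_pair els15 = K6_pairs.
Proof.
have : all (fun q => q.1 < q.2 < 6) K6_pairs by [].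
rewrite /els15; elim: K6_pairs => //= -[i j] s IHs /andP[/andP[/= ij j6] /IHs es].
have i6 := ltn_trans ij j6.
case: insubP => [t _ /= et|] /=; last by rewrite !inordK ?ij.
by rewrite es /K6_pair /ends /= et !inordK.
Qed.

Lemma els15_uniq : uniq els15.
Proof. by apply: (@map_uniq _ _ K6_pair); rewrite map_els15. Qed.

Lemma els15_full (t : edge K6) : t \in els15.
Proof.
rewrite -(mem_map K6_pair_inj) map_els15; case: t => [[[i i6] [j j6]] ij].
rewrite /K6_pair /=; have {}ij : i < j by [].
have h : all (fun i => all (fun j => (i < j) ==> ((i, j) \in K6_pairs)) (iota 0 6)) (iota 0 6).
  by vm_compute.
by have /allP/(_ i)/[!mem_iota]/(_ i6)/allP/(_ j)/[!mem_iota]/(_ j6) := h; rewrite ij.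
Qed.

Lemma size_els15 : size els15 = 15.
Proof. by rewrite -(size_map K6_pair) map_els15. Qed.

Lemma word_K6_star (x : vertex K6) :
  word els15 (coboundary (@ends K6) [set x]) = star_word K6_pairs x.
Proof.
rewrite -map_els15 /star_word -map_comp; apply: eq_map => t /=.
by rewrite !inE -!val_eqE.
Qed.

Definition K6_cycle (w : seq bool) : bool :=
  all (fun v => ~~ dotw w (star_word K6_pairs v)) (iota 0 6).

Definition K6_words : seq (seq bool) := [seq w <- all_words 15 | K6_cycle w].

Definition K6_space : {set {set edge K6}} := perp setT (cuts (@ends K6)).

Lemma in_K6_space X : (X \in K6_space) = (word els15 X \in K6_words).
Proof.
have aw : word els15 X \in all_words 15.
  by have := mem_all_words (word els15 X); rewrite size_word size_els15.
rewrite mem_filter aw andbT; apply/perp_cutsP/allP => [pX v|cX x].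
  rewrite mem_iota => v6; have := pX (Ordinal v6 : vertex K6).
  by rewrite (dotp_word els15_uniq els15_full) word_K6_star => ->.
apply: negbTE; rewrite (dotp_word els15_uniq els15_full) word_K6_star.
by apply: cX; rewrite mem_iota (ltn_ord x).
Qed.

Lemma K6_words_size w : w \in K6_words -> size w = 15.
Proof. by rewrite mem_filter => /andP[_ /size_all_words]. Qed.

(* For an edge e = ab and the edge f joining the two smallest vertices not on e,
   the graphs are the plane duals of K6 \ e / f and K6 / e / f. *)
Definition K6_certs : seq (certificate * certificate) :=
  [:: (([:: (1,1); (1,0); (0,2); (1,3); (3,2); (8,10); (10,9); (8,7); (7,9); (1,4); (1,5); (2,6); (5,8); (6,9); (3,7)],
    [:: (0,1); (0,2); (1,3); (1,9); (1,10); (2,11); (3,14); (5,12); (6,13); (8,5)], 0),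
   ([:: (7,7); (1,0); (0,2); (6,9); (6,3); (2,5); (5,8); (9,8); (3,1); (7,10); (7,11); (7,4); (11,8); (4,1); (7,6)],
    [:: (0,1); (0,2); (1,8); (1,13); (2,5); (3,4); (4,11); (5,6); (6,3); (7,9); (7,10)], 0));
   (([:: (1,0); (1,1); (0,2); (1,3); (3,2); (8,10); (1,4); (1,5); (2,6); (10,9); (8,7); (7,9); (5,8); (6,9); (3,7)],
    [:: (0,0); (0,2); (1,3); (1,6); (1,7); (2,8); (3,14); (5,12); (6,13); (8,5)], 0),
   ([:: (1,0); (7,7); (0,2); (6,9); (6,3); (2,5); (7,10); (7,11); (7,4); (5,8); (9,8); (3,1); (11,8); (4,1); (7,6)],
    [:: (0,0); (0,2); (1,11); (1,13); (2,5); (3,4); (4,8); (5,9); (6,3); (7,6); (7,7)], 0));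
   (([:: (1,0); (0,2); (1,1); (1,3); (3,2); (1,4); (8,10); (1,5); (2,6); (10,9); (5,8); (6,9); (8,7); (7,9); (3,7)],
    [:: (0,0); (0,1); (1,3); (1,5); (1,7); (2,8); (3,14); (5,10); (6,11); (8,6)], 0),
   ([:: (1,0); (0,2); (6,6); (7,11); (7,4); (6,9); (2,5); (6,10); (6,3); (5,8); (10,8); (3,1); (11,8); (4,1); (6,7)],
    [:: (0,0); (0,1); (1,11); (1,13); (2,6); (3,8); (4,4); (5,9); (6,5); (6,7); (7,3)], 0));
   (([:: (1,0); (0,2); (1,3); (1,1); (3,2); (1,4); (1,5); (8,10); (2,6); (5,8); (10,9); (6,9); (8,7); (3,7); (7,9)],
    [:: (0,0); (0,1); (1,2); (1,5); (1,6); (2,8); (3,13); (5,9); (6,11); (8,7)], 0),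
   ([:: (1,0); (0,2); (7,11); (6,6); (7,4); (6,9); (6,10); (2,5); (6,3); (10,8); (5,8); (3,1); (11,8); (6,7); (4,1)],
    [:: (0,0); (0,1); (1,11); (1,14); (2,7); (3,8); (4,4); (5,10); (6,5); (6,6); (7,2)], 0));
   (([:: (1,0); (0,2); (1,3); (3,2); (1,1); (1,4); (1,5); (2,6); (8,10); (5,8); (6,9); (10,9); (3,7); (8,7); (7,9)],
    [:: (0,0); (0,1); (1,2); (1,5); (1,6); (2,7); (3,12); (5,9); (6,10); (8,8)], 0),
   ([:: (1,0); (0,2); (7,11); (7,4); (6,6); (6,9); (6,10); (6,3); (2,5); (10,8); (3,1); (5,8); (6,7); (11,8); (4,1)],
    [:: (0,0); (0,1); (1,10); (1,14); (2,8); (3,7); (4,3); (5,11); (6,5); (6,6); (7,2)], 0));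
   (([:: (1,3); (2,6); (1,4); (1,0); (8,10); (1,1); (3,8); (1,5); (5,8); (6,9); (2,7); (7,9); (0,2); (10,9); (5,7)],
    [:: (0,3); (0,12); (1,0); (1,2); (1,7); (2,1); (2,10); (3,6); (6,9); (8,4)], 0),
   ([:: (8,11); (10,6); (1,3); (1,0); (1,4); (1,1); (11,10); (5,7); (5,9); (6,2); (7,2); (9,8); (0,2); (4,8); (1,5)],
    [:: (0,3); (0,12); (1,2); (1,4); (1,14); (2,9); (2,10); (4,13); (5,8); (6,1); (8,0)], 0));
   (([:: (1,3); (1,4); (2,6); (1,0); (8,10); (3,8); (1,1); (1,5); (5,8); (6,9); (0,2); (10,9); (2,7); (7,9); (5,7)],
    [:: (0,3); (0,10); (1,0); (1,1); (1,7); (2,2); (2,12); (3,5); (6,9); (8,4)], 0),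
   ([:: (8,11); (1,3); (10,6); (1,0); (1,4); (11,10); (1,1); (5,7); (5,9); (6,2); (0,2); (4,8); (7,2); (9,8); (1,5)],
    [:: (0,3); (0,10); (1,1); (1,4); (1,14); (2,9); (2,12); (4,11); (5,8); (6,2); (8,0)], 0));
   (([:: (1,3); (1,4); (1,0); (2,6); (8,10); (3,8); (1,5); (1,1); (5,8); (0,2); (6,9); (10,9); (2,7); (5,7); (7,9)],
    [:: (0,2); (0,9); (1,0); (1,1); (1,6); (2,3); (2,12); (3,5); (6,10); (8,4)], 0),
   ([:: (8,11); (1,3); (1,0); (10,6); (1,4); (11,10); (5,7); (1,1); (5,9); (0,2); (6,2); (4,8); (7,2); (1,5); (9,8)],
    [:: (0,2); (0,9); (1,1); (1,4); (1,13); (2,10); (2,12); (4,11); (5,8); (6,3); (8,0)], 0));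
   (([:: (1,3); (1,4); (1,0); (8,10); (2,6); (3,8); (1,5); (5,8); (1,1); (0,2); (10,9); (6,9); (5,7); (2,7); (7,9)],
    [:: (0,2); (0,9); (1,0); (1,1); (1,6); (2,4); (2,13); (3,5); (6,11); (8,3)], 0),
   ([:: (8,11); (1,3); (1,0); (1,4); (10,6); (11,10); (5,7); (5,9); (1,1); (0,2); (4,8); (6,2); (1,5); (7,2); (9,8)],
    [:: (0,2); (0,9); (1,1); (1,3); (1,12); (2,11); (2,13); (4,10); (5,7); (6,4); (8,0)], 0));
   (([:: (1,3); (1,4); (2,6); (1,0); (8,10); (4,8); (6,9); (0,2); (10,9); (1,1); (1,5); (5,8); (2,7); (7,9); (5,7)],
    [:: (0,3); (0,7); (1,0); (1,1); (1,10); (2,2); (2,12); (4,5); (6,6); (8,4)], 0),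
   ([:: (1,3); (8,11); (10,6); (1,0); (1,4); (11,10); (6,2); (0,2); (4,8); (1,1); (5,7); (5,9); (7,2); (9,8); (1,5)],
    [:: (0,3); (0,7); (1,0); (1,4); (1,14); (2,6); (2,12); (4,8); (5,11); (6,2); (8,1)], 0));
   (([:: (1,3); (1,4); (1,0); (2,6); (8,10); (4,8); (0,2); (6,9); (10,9); (1,5); (1,1); (5,8); (2,7); (5,7); (7,9)],
    [:: (0,2); (0,6); (1,0); (1,1); (1,9); (2,3); (2,12); (4,5); (6,7); (8,4)], 0),
   ([:: (1,3); (8,11); (1,0); (10,6); (1,4); (11,10); (0,2); (6,2); (4,8); (5,7); (1,1); (5,9); (7,2); (1,5); (9,8)],
    [:: (0,2); (0,6); (1,0); (1,4); (1,13); (2,7); (2,12); (4,8); (5,11); (6,3); (8,1)], 0));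
   (([:: (1,3); (1,4); (1,0); (8,10); (2,6); (4,8); (0,2); (10,9); (6,9); (1,5); (5,8); (1,1); (5,7); (2,7); (7,9)],
    [:: (0,2); (0,6); (1,0); (1,1); (1,9); (2,4); (2,13); (4,5); (6,8); (8,3)], 0),
   ([:: (1,3); (8,11); (1,0); (1,4); (10,6); (11,10); (0,2); (4,8); (6,2); (5,7); (5,9); (1,1); (1,5); (7,2); (9,8)],
    [:: (0,2); (0,6); (1,0); (1,3); (1,12); (2,8); (2,13); (4,7); (5,10); (6,4); (8,1)], 0));
   (([:: (1,3); (1,0); (1,4); (2,6); (8,10); (0,2); (4,8); (6,9); (10,9); (1,5); (2,7); (5,7); (1,1); (5,8); (7,9)],
    [:: (0,1); (0,5); (1,0); (1,2); (1,9); (2,3); (2,10); (4,6); (6,7); (8,4)], 0),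
   ([:: (1,3); (1,0); (8,11); (10,6); (1,4); (0,2); (11,10); (6,2); (4,8); (5,7); (7,2); (1,5); (1,1); (5,9); (9,8)],
    [:: (0,1); (0,5); (1,0); (1,4); (1,11); (2,7); (2,10); (4,8); (5,13); (6,3); (8,2)], 0));
   (([:: (1,3); (1,0); (1,4); (8,10); (2,6); (0,2); (4,8); (10,9); (6,9); (1,5); (5,7); (2,7); (5,8); (1,1); (7,9)],
    [:: (0,1); (0,5); (1,0); (1,2); (1,9); (2,4); (2,11); (4,6); (6,8); (8,3)], 0),
   ([:: (1,3); (1,0); (8,11); (1,4); (10,6); (0,2); (11,10); (4,8); (6,2); (5,7); (1,5); (7,2); (5,9); (1,1); (9,8)],
    [:: (0,1); (0,5); (1,0); (1,3); (1,10); (2,8); (2,11); (4,7); (5,12); (6,4); (8,2)], 0));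
   (([:: (1,3); (1,0); (8,10); (1,4); (2,6); (0,2); (10,9); (4,8); (6,9); (5,7); (1,5); (2,7); (5,8); (7,9); (1,1)],
    [:: (0,1); (0,5); (1,0); (1,3); (1,10); (2,4); (2,11); (4,7); (6,8); (8,2)], 0),
   ([:: (1,3); (1,0); (1,4); (8,11); (10,6); (0,2); (4,8); (11,10); (6,2); (1,5); (5,7); (7,2); (5,9); (9,8); (1,1)],
    [:: (0,1); (0,5); (1,0); (1,2); (1,9); (2,8); (2,11); (4,6); (5,12); (6,4); (8,3)], 0)) ]%N.

Lemma K6_certified : certify_minors 15 K6_words K6_certs.
Proof. by vm_compute. Qed.

Lemma K6_proper_minor N : proper_minor N (cycle_matroid K6) -> even_cut N.
Proof.
apply: (@proper_minor_even_cut _ els15 els15_uniq els15_full (cycle_matroid K6) N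
  K6_space K6_words K6_certs _ (cycle_matroid_cycle_space K6) in_K6_space) => //;
  rewrite size_els15; [exact: K6_words_size | exact: K6_certified].
Qed.

Definition K6_words_avoiding (s : seq bool) : seq (seq bool) :=
  [seq w <- K6_words | ~~ has (fun q => q.1 && q.2) (zip w s)].

(** Invariants of K5, which is left when the star [s] of a vertex is removed: a cycle space of
    dimension 10 - 5 + 1 = 6, ten edges, and no cycle of length one or two. Uniqueness makes the
    length 64 a number of sets. *)
Definition K5_like (s : seq bool) : bool :=
  [&& size (K6_words_avoiding s) == 64, uniq (K6_words_avoiding s),
      weight (map negb s) == 10
    & all (fun w => has id w ==> (3 <= weight w)) (K6_words_avoiding s)].

Lemma K6_star_K5_like v : v < 6 -> K5_like (star_word K6_pairs v).
Proof.
have /allP h : all (fun v => K5_like (star_word K6_pairs v)) (iota 0 6) by vm_compute.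
by move=> v6; apply: h; rewrite mem_iota.
Qed.

Lemma K6_not_even_cut : ~ even_cut (cycle_matroid K6).
Proof.
have gK : ground (cycle_matroid K6) = setT by [].
case/(even_cut_matroid_space gK (cycle_matroid_cycle_space K6)) => V [p [ZW codim]].
rewrite -/K6_space in ZW codim.
(* For a cut [x] that is not a cycle of K6, [u] is a vertex of odd degree in [x]. A cut [w] avoiding
   the star of [u] has [symd w x] odd at [u], hence not a cycle, so [w] must be one. If there is no
   such [x], any vertex serves. *)
have [u uP] : exists u : vertex K6, forall w, w \in cuts p ->
    [disjoint w & coboundary (@ends K6) [set u]] -> w \in K6_space.
  have [WZ|/subsetPn[x xW xZ]] := boolP (cuts p \subset K6_space).
    by exists (ord0 : 'I_6) => w /(subsetP WZ).
  have [u xu] : exists u, dotp x (coboundary (@ends K6) [set u]).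
    apply/existsP; apply: contraR xZ => /existsPn xu.
    by apply/perp_cutsP => u; apply/negbTE/xu.
  exists u => w wW /dotp_disjoint wu; have [//||/perp_cutsP/(_ u)] := codim _ _ wW xW.
    by rewrite (negbTE xZ).
  by rewrite dotp_symdl wu xu.
(* Deleting the star of [u], with nothing contracted, gives a graph whose cuts are the cycles of K6
   avoiding that star. *)
set s := coboundary _ _ in uP; have [q qP] := cuts_minor p set0 s.
have cutqE w : (w \in cuts q) = (w \in K6_space) && [disjoint w & s].
  apply/idP/andP => [/qP[a [aW as_ ->]]|[wZ ws]].
    by rewrite setD0; split=> //; apply: uP.
  by apply/qP; exists w; rewrite setD0; split=> //; apply: (subsetP ZW).
have := K6_star_K5_like (ltn_ord u).
rewrite -word_K6_star -/s /K5_like; set L := K6_words_avoiding _.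
have inL w : (w \in cuts q) = (word els15 w \in L).
  rewrite cutqE in_K6_space [RHS]mem_filter andbC; congr (_ && _).
  rewrite -setI_eq0 zip_map_map has_map; apply/eqP/hasPn => [e0 t _|nw].
    by have := in_set0 t; rewrite -e0 in_setI /= => ->.
  by apply/setP => t; rewrite in_setI in_set0; have /negbTE := nw t (els15_full t).
case/and4P=> /eqP sL uL /eqP s10 /allP L3.
(* The value 5 is allowed because 64 exceeds [2 ^ 5]; the resulting bound would read 21 <= 20. *)
have := @cuts_girth3 _ _ q 5 (~: s).
rewrite (card_word els15_uniq els15_full (~: s)).
have -> : word els15 (~: s) = map negb (word els15 s).
  by rewrite -map_comp; apply: eq_map => t; rewrite /= inE.
rewrite s10; case/(_ _ _ _)/negP => //.
- rewrite -[2 ^ 5]/32; suff: 64 <= #|cuts q| by apply: leq_trans.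
  have sL' w : w \in L -> size w = size els15.
    by rewrite mem_filter size_els15 => /andP[_ /K6_words_size].
  rewrite -sL; apply: (leq_card_words els15_uniq) => // w wL.
  by rewrite inL word_setK ?sL' ?els15_uniq.
- by move=> w; rewrite cutqE -disjoints_subset => /andP[].
move=> w; rewrite inL (card_word els15_uniq els15_full) => /L3/implyP h.
by case/set0Pn=> t tw; apply: h; apply/hasP; exists true => //; apply/mapP; exists t; rewrite ?els15_full.
Qed.

Theorem theorem4p2 :
  excluded_minor even_cut (cycle_matroid (complete_graph 6)) /\
  excluded_minor even_cut (dual H12).
Proof.
split; split.
- exact: K6_not_even_cut.
- exact: K6_proper_minor.
- exact: H12_dual_not_even_cut.
exact: H12_dual_proper_minor.
Qed.
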